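(* Let $\mathcal H$ be a Hilbert space and let $G$ be a topological subgroup of the unitary group $U(\mathcal H)$ equipped with the uniform operator (operator norm) topology. If $G$ is amenable and has property $(T)$, then $G$ is maximally almost periodic.
   Context: ''Topological subgroup'' means a subgroup with the induced topology. A topological group $G$ is amenable if every continuous action of $G$ on a (non-empty) compact Hausdorff space admits an invariant regular Borel probability measure. A strongly continuous unitary representation $\pi$ of $G$ has almost invariant vectors if for every $\varepsilon>0$ and every compact $K\subseteq G$ there is a unit vector $\xi$ with $\|\xi-\pi_g\xi\|<\varepsilon$ for all $g\in K$. $G$ has property $(T)$ if every strongly continuous unitary representation of $G$ having almost invariant vectors has an invariant unit vector. $G$ is maximally almost periodic if its continuous finite-dimensional unitary representations separate points. *)

(* Defs.v *)
From HB Require Import structures.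
From mathcomp Require Import all_boot all_order all_algebra.
From mathcomp Require Import sesquilinear complex.
From mathcomp Require Import all_classical all_reals all_analysis.

Set Implicit Arguments.
Unset Strict Implicit.
Unset Printing Implicit Defensive.

Import Order.TTheory GRing.Theory Num.Theory.
Import numFieldNormedType.Exports.

Local Open Scope classical_set_scope.
Local Open Scope ring_scope.
Local Open Scope complex_scope.

HB.mixin Record Topological_isTopGroup G of Topological G & Group G := {
  mulg_continuous : continuous (fun p : G * G => (p.1 * p.2)%g);
  invg_continuous : continuous (fun x : G => (x^-1)%g)
}.

#[short(type="topGroupType")]
HB.structure Definition TopGroup :=
  {G of Topological G & Group G & Topological_isTopGroup G}.

Record subgroup (T : groupType) := Subgroup {
  subgroup_set :> set T;
  subgroup_closed : group_closed [in subgroup_set]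
}.

Section SubgroupTopGroup.
Variables (T : topGroupType) (A : subgroup T).

(* The topology on [set_type A] is the initial topology of the inclusion, i.e.
   the induced topology. *)
Definition subgroup_type : Type := set_type A.

HB.instance Definition _ := SubChoice.on subgroup_type.
HB.instance Definition _ :=
  SubChoice_isSubGroup.Build T [in subgroup_set A] subgroup_type
    (subgroup_closed A).
HB.instance Definition _ := Topological.copy subgroup_type (set_type A).

Let mulg_continuous_sub :
  continuous (fun p : subgroup_type * subgroup_type => (p.1 * p.2)%g).
Proof.
have valc : continuous (val : subgroup_type -> T).
  exact: (@initial_continuous _ _ (set_val : set_type A -> T)).
apply: (@continuous_comp_initial _ _ _ (set_val : set_type A -> T)).
move=> p.
apply: (@continuous_comp _ _ _
  (fun p : subgroup_type * subgroup_type => (val p.1, val p.2))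
  (fun q : T * T => (q.1 * q.2)%g)); last exact: mulg_continuous.
by apply: cvg_pair => /=; apply: continuous_comp;
  do 1?[exact: cvg_fst|exact: cvg_snd]; exact: valc.
Qed.

Let invg_continuous_sub : continuous (fun x : subgroup_type => (x^-1)%g).
Proof.
have valc : continuous (val : subgroup_type -> T).
  exact: (@initial_continuous _ _ (set_val : set_type A -> T)).
apply: (@continuous_comp_initial _ _ _ (set_val : set_type A -> T)).
move=> x.
apply: (@continuous_comp _ _ _ (val : subgroup_type -> T)
  (fun y : T => (y^-1)%g)); [exact: valc|exact: invg_continuous].
Qed.

HB.instance Definition _ :=
  Topological_isTopGroup.Build subgroup_type
    mulg_continuous_sub invg_continuous_sub.

End SubgroupTopGroup.

(* [{dot V for Num.conj}] is a positive definite Hermitian form, linear in its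
   first argument and conjugate-linear in the second. *)
HB.mixin Record CompleteNormedModule_isHilbert (R : realType) V
    of CompleteNormedModule R[i] V := {
  inner : {dot V for @Num.conj R[i]};
  inner_norm : forall x : V, `|x| ^+ 2 = inner x x
}.

#[short(type="hilbertType")]
HB.structure Definition Hilbert (R : realType) :=
  {V of CompleteNormedModule R[i] V & CompleteNormedModule_isHilbert R V}.

(* An inner product preserving linear operator is onto iff it is unitary. *)
Record unitary (R : realType) (V : hilbertType R) := Unitary {
  unitary_fun :> V -> V;
  unitary_linear : linear unitary_fun;
  unitary_inner : forall x y, inner (unitary_fun x) (unitary_fun y) = inner x y;
  unitary_surj : forall y, exists x, unitary_fun x = y
}.

(* The norm of a normed module over [R[i]] takes its values in [R[i]] (they are
   nonnegative reals there), whence the real part. The supremum is meaningful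
   for bounded operators only; it is applied to differences of unitaries. *)
Definition opnorm (R : realType) (V : hilbertType R) (f : V -> V) : R :=
  sup [set complex.Re `|f x| | x in [set x : V | `|x| <= 1]].

Section UnitaryGroup.
Variables (R : realType) (V : hilbertType R).
Implicit Types u v w : unitary V.

HB.instance Definition _ u := GRing.isLinear.Build R[i] V V *:%R u
  (unitary_linear u).

Lemma unitary_ext u v : u =1 v -> u = v.
Proof.
case: u v => [u lu iu su] [v lv iv sv] /= /funext uv; subst v.
by rewrite (Prop_irrelevance lu lv) (Prop_irrelevance iu iv)
  (Prop_irrelevance su sv).
Qed.

Lemma unitary_norm u x : `|u x| = `|x|.
Proof.
apply/eqP; rewrite -(@eqrXn2 _ 2)//.
by rewrite !inner_norm unitary_inner.
Qed.

Lemma unitary_inj u : injective u.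
Proof.
move=> x y uxy; apply/eqP; rewrite -subr_eq0 -normr_eq0.
by rewrite -(unitary_norm u) raddfB /= uxy subrr normr0.
Qed.

Definition unitary_one : unitary V :=
  @Unitary R V id (fun _ _ _ => erefl) (fun _ _ => erefl)
    (fun y => ex_intro _ y erefl).

Lemma unitary_mul_linear u v : linear (u \o v).
Proof. by move=> a x y /=; rewrite !linearP. Qed.

Lemma unitary_mul_inner u v x y : inner ((u \o v) x) ((u \o v) y) = inner x y.
Proof. by rewrite /= !unitary_inner. Qed.

Lemma unitary_mul_surj u v y : exists x, (u \o v) x = y.
Proof.
have [z <-] := unitary_surj u y; have [x <-] := unitary_surj v z.
by exists x.
Qed.

Definition unitary_mul u v : unitary V :=
  Unitary (unitary_mul_linear u v) (unitary_mul_inner u v)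
    (unitary_mul_surj u v).

Definition unitary_inv_fun u (y : V) : V := sval (cid (unitary_surj u y)).

Lemma unitary_inv_funK u : cancel (unitary_inv_fun u) u.
Proof. by move=> y; rewrite /unitary_inv_fun; case: cid. Qed.

Lemma unitary_funK u : cancel u (unitary_inv_fun u).
Proof. by move=> x; apply: (unitary_inj (u := u)); rewrite unitary_inv_funK. Qed.

Lemma unitary_inv_linear u : linear (unitary_inv_fun u).
Proof.
move=> a x y; apply: (unitary_inj (u := u)).
by rewrite unitary_inv_funK linearP /= !unitary_inv_funK.
Qed.

Lemma unitary_inv_inner u x y :
  inner (unitary_inv_fun u x) (unitary_inv_fun u y) = inner x y.
Proof. by rewrite -(unitary_inner u) !unitary_inv_funK. Qed.

Lemma unitary_inv_surj u y : exists x, unitary_inv_fun u x = y.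
Proof. by exists (u y); rewrite unitary_funK. Qed.

Definition unitary_inv u : unitary V :=
  Unitary (unitary_inv_linear u) (unitary_inv_inner u) (unitary_inv_surj u).

HB.instance Definition _ := gen_eqMixin (unitary V).
HB.instance Definition _ := gen_choiceMixin (unitary V).

Let unitary_mulA : associative unitary_mul.
Proof. by move=> u v w; apply: unitary_ext. Qed.

Let unitary_mul1 : left_id unitary_one unitary_mul.
Proof. by move=> u; apply: unitary_ext. Qed.

Let unitary_1mul : right_id unitary_one unitary_mul.
Proof. by move=> u; apply: unitary_ext. Qed.

Let unitary_mulV : left_inverse unitary_one unitary_inv unitary_mul.
Proof. by move=> u; apply: unitary_ext => x /=; rewrite unitary_funK. Qed.

Let unitary_Vmul : right_inverse unitary_one unitary_inv unitary_mul.
Proof. by move=> u; apply: unitary_ext => x /=; rewrite unitary_inv_funK. Qed.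

HB.instance Definition _ := isGroup.Build (unitary V)
  unitary_mulA unitary_mul1 unitary_1mul unitary_mulV unitary_Vmul.

(* The operator norm distance; [unitary V] carries the corresponding metric
   topology. *)
Definition unitary_dist u v : R := opnorm (fun x => u x - v x).

Let nrm (x : V) : R := complex.Re `|x|.

Let nrmE x : `|x| = (nrm x)%:C.
Proof. by rewrite /nrm RRe_real// normr_real. Qed.

Let nrm_ge0 x : 0 <= nrm x.
Proof. by rewrite -lecR -nrmE; exact: normr_ge0. Qed.

Let nrmD x y : nrm (x + y) <= nrm x + nrm y.
Proof. by rewrite -lecR rmorphD/= -!nrmE ler_normD. Qed.

Lemma unitary_dist_ub u v x : `|x| <= 1 -> nrm (u x - v x) <= unitary_dist u v.
Proof.
move=> x1; apply: ub_le_sup; last by exists x.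
exists 2 => _ [y /= y1 <-].
rewrite -/(nrm _) (le_trans (nrmD _ _))// /nrm normrN !unitary_norm.
have y1' : nrm y <= 1 by rewrite -lecR -nrmE.
by rewrite (_ : 2 = 1 + 1)// lerD.
Qed.

Lemma unitary_dist_le u v (M : R) :
  (forall x, `|x| <= 1 -> nrm (u x - v x) <= M) -> unitary_dist u v <= M.
Proof.
move=> uvM; apply: ge_sup.
  by exists (nrm (u 0 - v 0)); exists 0 => //=; rewrite normr0.
by move=> _ [x /= x1 <-]; exact: uvM.
Qed.

Let unitary_distxx u : unitary_dist u u = 0.
Proof.
apply/eqP; rewrite eq_le; apply/andP; split.
  by apply: unitary_dist_le => x _; rewrite subrr /nrm normr0.
apply: le_trans (unitary_dist_ub u u (x := 0) _); last by rewrite normr0.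
exact: nrm_ge0.
Qed.

Let unitary_dist_eq0 u v : unitary_dist u v = 0 -> u = v.
Proof.
move=> uv0; apply: unitary_ext => x.
have key y : `|y| <= 1 -> u y = v y.
  move=> /(unitary_dist_ub u v); rewrite uv0 => uvy.
  apply/eqP; rewrite -subr_eq0 -normr_eq0 nrmE.
  by rewrite (_ : nrm _ = 0)//; apply/eqP; rewrite eq_le uvy nrm_ge0.
have [->|x0] := eqVneq x 0; first by rewrite !raddf0.
have nx0 : `|x| != 0 by rewrite normr_eq0.
have : u (`|x|^-1 *: x) = v (`|x|^-1 *: x).
  by apply: key; rewrite normrZ normfV normr_id mulVf.
by rewrite !linearZ/= => /(scalerI _); apply; rewrite invr_eq0.
Qed.

Let unitary_dist_sym u v : unitary_dist u v = unitary_dist v u.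
Proof.
by rewrite /unitary_dist /opnorm; congr sup; apply/seteqP; split => _ [x x1 <-];
  exists x => //; rewrite distrC.
Qed.

Let unitary_dist_triangle v u w :
  unitary_dist u w <= unitary_dist u v + unitary_dist v w.
Proof.
apply: unitary_dist_le => x x1.
rewrite -(subrKA (v x)) (le_trans (nrmD _ _))//.
by rewrite lerD// unitary_dist_ub.
Qed.

HB.instance Definition _ := isMetric.Build R (unitary V)
  unitary_distxx unitary_dist_eq0 unitary_dist_sym unitary_dist_triangle.

Let nbhs_unitaryP u (P : set (unitary V)) :
  nbhs u P <-> exists2 e : R, 0 < e & forall v, unitary_dist u v < e -> P v.
Proof.
split.
  by move=> /nbhs_ballP [e e0 eP]; exists e.
by move=> [e e0 eP]; apply/nbhs_ballP; exists e.
Qed.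

Lemma unitary_dist_mul u v u' v' :
  unitary_dist (unitary_mul u v) (unitary_mul u' v') <=
    unitary_dist u u' + unitary_dist v v'.
Proof.
apply: unitary_dist_le => x x1 /=.
rewrite -(subrKA (u (v' x))) addrC (le_trans (nrmD _ _))//.
apply: lerD; first by rewrite unitary_dist_ub// unitary_norm.
by rewrite -raddfB /nrm unitary_norm -/(nrm _) unitary_dist_ub.
Qed.

Lemma unitary_dist_inv u v :
  unitary_dist (unitary_inv u) (unitary_inv v) <= unitary_dist u v.
Proof.
apply: unitary_dist_le => x x1 /=.
rewrite /nrm -(unitary_norm u) raddfB /= unitary_inv_funK.
rewrite -[X in X - _](unitary_inv_funK v) distrC -/(nrm _) unitary_dist_ub//.
by rewrite (unitary_norm (unitary_inv v)).
Qed.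

Let unitary_mul_continuous :
  continuous (fun p : unitary V * unitary V => (p.1 * p.2)%g).
Proof.
move=> [u v] P /nbhs_unitaryP [e e0 eP].
have e20 : 0 < e / 2 by rewrite divr_gt0.
exists ([set u' | unitary_dist u u' < e / 2],
        [set v' | unitary_dist v v' < e / 2]).
  by split; apply/nbhs_unitaryP; exists (e / 2).
move=> [u' v'] [/= uu' vv']; apply: eP.
by rewrite (le_lt_trans (unitary_dist_mul _ _ _ _))// (splitr e) ltrD.
Qed.

Let unitary_inv_continuous : continuous (fun u : unitary V => (u^-1)%g).
Proof.
move=> u P /nbhs_unitaryP [e e0 eP]; apply/nbhs_unitaryP; exists e => // v uv.
by apply: eP; rewrite (le_lt_trans (unitary_dist_inv _ _)).
Qed.

HB.instance Definition _ := Topological_isTopGroup.Build (unitary V)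
  unitary_mul_continuous unitary_inv_continuous.

End UnitaryGroup.

Section Properties.
Variables (R : realType) (G : topGroupType).

Definition is_group_action (X : Type) (a : G -> X -> X) :=
  (forall x, a 1%g x = x) /\ (forall g h x, a (g * h)%g x = a g (a h x)).

Definition borel (X : ptopologicalType) := g_sigma_algebraType (@open X).

Definition regular_measure (X : ptopologicalType)
    (mu : set (borel X) -> \bar R) :=
  forall A : set (borel X), measurable A ->
    mu A = ereal_inf
      [set mu U | U in [set U : set X | open U /\ A `<=` U]] /\
    mu A = ereal_sup
      [set mu K | K in [set K : set X | compact K /\ K `<=` A]].

(* A pointed topological space is in particular non-empty, and every non-empty
   space can be pointed; the point plays no other role. *)
Definition amenable :=
  forall (X : ptopologicalType) (a : G -> X -> X),
    compact [set: X] -> hausdorff_space X ->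
    is_group_action a -> continuous (fun p : G * X => a p.1 p.2) ->
  exists mu : probability (borel X) R,
    regular_measure mu /\
    forall (g : G) (A : set (borel X)), measurable A -> mu (a g @^-1` A) = mu A.

Definition strongly_continuous (V : hilbertType R) (pi : G -> unitary V) :=
  forall xi : V, continuous (fun g => pi g xi).

Definition almost_invariant_vectors (V : hilbertType R) (pi : G -> unitary V) :=
  forall (e : R) (K : set G), 0 < e -> compact K ->
    exists xi : V, `|xi| = 1 /\ forall g, K g -> `|xi - pi g xi| < e%:C.

Definition invariant_unit_vector (V : hilbertType R) (pi : G -> unitary V) :=
  exists xi : V, `|xi| = 1 /\ forall g, pi g xi = xi.

Definition property_T :=
  forall (V : hilbertType R) (pi : {multiplicative G -> unitary V}),
    strongly_continuous pi -> almost_invariant_vectors pi ->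
    invariant_unit_vector pi.

Definition finite_dimensional (V : hilbertType R) :=
  exists (n : nat) (e : 'I_n -> V),
    forall x, exists c : 'I_n -> R[i], x = \sum_(i < n) c i *: e i.

Definition maximally_almost_periodic :=
  forall g h : G, g <> h ->
  exists (V : hilbertType R) (pi : {multiplicative G -> unitary V}),
    [/\ finite_dimensional V, continuous pi & pi g <> pi h].

End Properties.

(* Main.v *)
(* Let g <> h in G and let Z be the closed G-invariant space of the x with gkx = hkx
   for all k; some unit vector x0 is orthogonal to Z. Suppose that the finite-dimensional
   representations of G do not separate g and h.
   G acts by conjugation on the Hilbert-Schmidt operators vanishing on Z, continuously
   because G carries the norm topology. As G is amenable, there are finitely supported
   probability measures nu on G almost invariant against the uniformly bounded,
   equicontinuous functions k |-> <sgn(c) k x0, k x0> (Reiter's property). By the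
   Powers-Stormer inequality the square root of the density operator
   sum_k nu(k) (k x0 (x) k x0), a unit vector vanishing on Z, is almost invariant in the
   Hilbert-Schmidt norm. Property (T) now gives a nonzero Hilbert-Schmidt operator T
   commuting with G and vanishing on Z. Its top singular space, where |Tx| = |T| |x|, is
   nonzero, finite-dimensional and G-invariant. Hence g and h agree on it, so that it is
   contained in Z and T vanishes on it, a contradiction. *)

Require Import Defs.
From HB Require Import structures.
From mathcomp Require Import all_boot all_order all_algebra.
From mathcomp Require Import sesquilinear complex spectral ring lra.
From mathcomp Require Import all_classical all_reals all_analysis.
From mathcomp Require Import measurable_realfun.

Set Implicit Arguments.
Unset Strict Implicit.
Unset Printing Implicit Defensive.

Import Order.TTheory GRing.Theory Num.Theory.
Import numFieldNormedType.Exports.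

Local Open Scope classical_set_scope.
Local Open Scope ring_scope.
Local Open Scope complex_scope.

(** * Sublinear functionals *)

(** [G] need not be locally compact, so no regular representation is at hand to which property (T)
    could be applied; Hilbert-Schmidt operators take its place. Amenability is given only through
    invariant measures on compact [G]-spaces. This explains the detour through a compact set of
    functions: the action on it has to be jointly continuous, which the equicontinuity ensures. The
    operator [c] is the difference between the moved and the original square root. It depends on the
    measure, so the measure must be almost invariant against all sign operators at once; hence a
    minimax argument of Mazur-Orlicz type. Square roots are taken because a density has norm 1 in
    the trace norm, not in the Hilbert space. The condition on [Z] ties the outcome to the pair:
    without it property (T) would give some finite-dimensional subrepresentation, on which [g] and
    [h] might agree. No orthonormal basis of [H] is chosen: Hilbert-Schmidt norms and inner products
    are suprema and limits over finite orthonormal families. *)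

Section Sublinear.
Variables (R : realType) (E : lmodType R).
Implicit Types (p : E -> R) (C : E -> R -> Prop).

Definition sublinear p :=
  (forall x y, p (x + y) <= p x + p y) /\
  (forall t x, 0 <= t -> p (t *: x) = t * p x).

Definition convex_cone C :=
  [/\ C 0 0,
      forall c t c' t', C c t -> C c' t' -> C (c + c') (t + t') &
      forall a c t, 0 <= a -> C c t -> C (a *: c) (a * t)].

(** For a sublinear [p] that dominates a convex cone [C], a linear functional lies below the
    envelope exactly when it lies below [p] and is at least [t] at [c] for all pairs of [C]. Both
    constraints thus become domination by a single sublinear functional. *)
Definition envelope p C (x : E) : R :=
  inf [set p (x + ct.1) - ct.2 | ct in [set ct : E * R | C ct.1 ct.2]].

Lemma sublinear0 p : sublinear p -> p 0 = 0.
Proof. by move=> [_ ps]; rewrite -(scale0r (0 : E)) ps// mul0r. Qed.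

Section Envelope.
Variables (p : E -> R) (C : E -> R -> Prop).
Hypotheses (ps : sublinear p) (CC : convex_cone C)
  (Cp : forall c t, C c t -> t <= p c).

Let env_lb x : lbound
  [set p (x + ct.1) - ct.2 | ct in [set ct : E * R | C ct.1 ct.2]] (- p (- x)).
Proof.
move=> _ [[c t] /= Cct <-]; rewrite lerNl opprB lerBlDl.
rewrite (le_trans (Cp Cct))// -[c in leLHS](addKr x) addrC.
by rewrite (le_trans (ps.1 _ _)).
Qed.

Let env_neq0 x :
  [set p (x + ct.1) - ct.2 | ct in [set ct : E * R | C ct.1 ct.2]] !=set0.
Proof. by exists (p (x + 0) - 0), (0, 0) => //=; case: CC. Qed.

Lemma envelope_le x c t : C c t -> envelope p C x <= p (x + c) - t.
Proof.
by move=> Cct; apply: ge_inf; [exists (- p (- x)); exact: env_lb|exists (c, t)].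
Qed.

Lemma le_envelope x M :
  (forall c t, C c t -> M <= p (x + c) - t) -> M <= envelope p C x.
Proof.
by move=> H; apply: lb_le_inf => // _ [[c t] /= Cct <-]; exact: H.
Qed.

Lemma envelope_sublinear : sublinear (envelope p C).
Proof.
case: CC => C00 CD CZ.
have envZ t x : 0 < t -> envelope p C (t *: x) <= t * envelope p C x.
  move=> t0; rewrite -ler_pdivrMl//; apply: le_envelope => c s Ccs.
  rewrite ler_pdivrMl// mulrBr -(ps.2 _ _ (ltW t0)) scalerDr.
  by apply: envelope_le; apply: CZ => //; exact: ltW.
split=> [x y|t x].
  rewrite -lerBlDr; apply: le_envelope => c t Cct.
  rewrite lerBlDr -lerBlDl; apply: le_envelope => d s Cds; rewrite lerBlDl.
  rewrite (le_trans (envelope_le _ (CD _ _ _ _ Cct Cds)))//.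
  by have := ps.1 (x + c) (y + d); rewrite addrACA; lra.
rewrite le_eqVlt => /predU1P[<-|t0].
  rewrite scale0r mul0r; apply/eqP; rewrite eq_le; apply/andP; split.
    by have := envelope_le 0 C00; rewrite addr0 subr0 (sublinear0 ps).
  by apply: le_envelope => c t' /Cp ?; rewrite add0r subr_ge0.
apply/eqP; rewrite eq_le envZ//= -ler_pdivlMl//.
rewrite -[x in leLHS](scalerK (lt0r_neq0 t0)).
by rewrite envZ// invr_gt0.
Qed.

End Envelope.

(** Zorn's lemma for the reversed pointwise order. A chain is bounded by its pointwise infimum,
    which is finite because [- p (- x)] lies below every member. *)
Lemma minimal_sublinear p : sublinear p ->
  exists m, [/\ sublinear m, (forall x, m x <= p x) &
    forall q, sublinear q -> (forall x, q x <= m x) -> q = m].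
Proof.
move=> ps.
pose T := {q : E -> R | sublinear q /\ forall x, q x <= p x}.
pose le (q q' : T) := `[< forall x, sval q' x <= sval q x >].
have [|||A Atot|m mmin] := @Zorn T le.
- by move=> q; apply/asboolP.
- by move=> q r s /asboolP qr /asboolP rs; apply/asboolP => x; apply: le_trans (qr x).
- move=> [q hq] [r hr] /asboolP /= qr /asboolP /= rq; apply: eq_exist => /=; apply/funext => x.
  by apply/eqP; rewrite eq_le qr rq.
- have [->|/set0P[q0 Aq0]] := eqVneq A set0.
    by exists (exist _ p (conj ps (fun x => lexx _))).
  pose inf_A x := inf [set sval q x | q in A].
  have lbA x : lbound [set sval q x | q in A] (- p (- x)).
    move=> _ [[q [qs qp]] _ /= <-]; rewrite lerNl (le_trans _ (qp _))//.
    by rewrite -subr_ge0 opprK -(sublinear0 qs) -(addNr x) qs.1.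
  have infA_le q x : A q -> inf_A x <= sval q x.
    by move=> Aq; apply: ge_inf; [exists (- p (- x))|exists q].
  have le_infA x M : (forall q, A q -> M <= sval q x) -> M <= inf_A x.
    move=> MA; apply: lb_le_inf; first by exists (sval q0 x), q0.
    by move=> _ [q Aq <-]; exact: MA.
  suff sA : sublinear inf_A.
    have pA x : inf_A x <= p x by rewrite (le_trans (infA_le q0 x Aq0))//; exact: (svalP q0).2.
    exists (exist _ inf_A (conj sA pA)) => q Aq; apply/asboolP => x /=.
    exact: infA_le.
  split=> [x y|t x t0].
    rewrite -lerBlDr; apply: (le_infA) => q Aq; rewrite lerBlDl -lerBlDr.
    apply: (le_infA) => r Ar; rewrite lerBlDr.
    (* Values at two different members [q] and [r] are compared through the smaller of the two,
       whence the subadditivity of the infimum. *)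
    have [/asboolP qr|/asboolP rq] := Atot q r Aq Ar.
      rewrite (le_trans (infA_le _ _ Ar))// (le_trans ((svalP r).1.1 _ _))//.
      by rewrite [leRHS]addrC lerD2r qr.
    rewrite (le_trans (infA_le _ _ Aq))// (le_trans ((svalP q).1.1 _ _))//.
    by rewrite [leRHS]addrC lerD2l rq.
  have infAZ s y : 0 < s -> inf_A (s *: y) <= s * inf_A y.
    move=> s0; rewrite -ler_pdivrMl//; apply: (le_infA) => q Aq.
    by rewrite ler_pdivrMl// -(svalP q).1.2 ?infA_le// ltW.
  move: t0; rewrite le_eqVlt => /predU1P[<-|t0].
    rewrite scale0r mul0r; apply/eqP; rewrite eq_le; apply/andP; split.
      by rewrite (le_trans (infA_le _ _ Aq0))// (sublinear0 (svalP q0).1).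
    by apply: (le_infA) => q _; rewrite (sublinear0 (svalP q).1).
  apply/eqP; rewrite eq_le infAZ//= -ler_pdivlMl//.
  rewrite -[x in leLHS](scalerK (lt0r_neq0 t0)).
  by rewrite infAZ// invr_gt0.
case: m => m [ms mp] in mmin *; exists m; split => // q qs qm.
have qp x : q x <= p x by exact: le_trans (mp x).
have /asboolP /mmin/(congr1 sval)// : forall x, sval (exist _ q (conj qs qp) : T) x <= m x.
by [].
Qed.

(** A minimal sublinear functional below the envelope is linear: minimality forces it to be odd, and
    subadditivity at opposite points then gives additivity. *)
Lemma mazur_orlicz p C : sublinear p -> convex_cone C ->
    (forall c t, C c t -> t <= p c) ->
  exists m : E -> R, [/\ linear m, forall x, m x <= p x &
    forall c t, C c t -> t <= m c].
Proof.
move=> ps CC Cp.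
have [m [ms mp mmin]] := minimal_sublinear (envelope_sublinear ps CC Cp).
(* The envelope of [m] along the ray of [y] is [m] itself, by minimality. *)
have mN y : m (- y) = - m y.
  pose D (c : E) (t : R) := exists2 a : R, 0 <= a & (c, t) = (a *: y, a * m y).
  have DC : convex_cone D.
    split=> [|c t c' t' [a a0 [-> ->]] [b b0 [-> ->]]|b c t b0 [a a0 [-> ->]]].
    - by exists 0; rewrite // scale0r mul0r.
    - by exists (a + b); rewrite ?addr_ge0// scalerDl mulrDl.
    - by exists (b * a); rewrite ?mulr_ge0// scalerA mulrA.
  have Dm c t : D c t -> t <= m c by move=> [a a0 [-> ->]]; rewrite ms.2.
  have mE : envelope m D = m.
    apply: mmin; first exact: envelope_sublinear.
    move=> x; have := envelope_le ms Dm x (c := 0) (t := 0).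
    by rewrite addr0 subr0; apply; case: DC.
  apply/eqP; rewrite eq_le; apply/andP; split.
    rewrite -{1}mE; have := envelope_le ms Dm (- y) (c := y) (t := m y).
    rewrite addNr (sublinear0 ms) sub0r; apply.
    by exists 1; rewrite // scale1r mul1r.
  by rewrite -subr_ge0 opprK -(sublinear0 ms) -(addNr y) ms.1.
have mD x y : m (x + y) = m x + m y.
  apply/eqP; rewrite eq_le ms.1/= -lerN2 -mN !opprD -!mN.
  exact: ms.1.
exists m; split.
- move=> a x y; rewrite mD; congr +%R.
  have [a0|a0] := leP 0 a; first exact: ms.2.
  rewrite -[a]opprK scaleNr mN ms.2 ?oppr_ge0 ?ltW//.
  by rewrite [RHS]scaleNr.
- move=> x; rewrite (le_trans (mp x))//.
  have := envelope_le ps Cp x (c := 0) (t := 0).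
  by rewrite addr0 subr0; apply; case: CC.
- move=> c t Cct; rewrite -[c]opprK mN lerNr (le_trans (mp _))//.
  have := envelope_le ps Cp (- c) Cct.
  by rewrite addNr (sublinear0 ps) sub0r.
Qed.

End Sublinear.

(** * Invariant means and Reiter's property *)

Section Mean.
Variables (R : realType) (G : topGroupType) (X : ptopologicalType)
  (a : G -> X -> X).
Hypotheses (amG : amenable R G) (cptX : compact [set: X])
  (T2X : hausdorff_space X) (aP : is_group_action a)
  (ac : continuous (fun p : G * X => a p.1 p.2)).

Lemma borel_continuous (f : X -> R) : continuous f ->
  measurable_fun [set: borel X] (f : borel X -> R).
Proof.
move=> /continuousP cf; apply: (measurability _ (RGenOpens.measurableE R)).
move=> _ [_ [x [y ->]] <-]; rewrite setTI; apply: sub_sigma_algebra.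
by apply: cf; exact: interval_open.
Qed.

Let act_continuous g : continuous (a g).
Proof.
move=> x; apply: (@continuous_comp _ _ _ (fun y => (g, y)) (fun p : G * X => a p.1 p.2)).
  by apply: cvg_pair => //=; exact: cvg_cst.
exact: ac.
Qed.

Let borel_act (g : G) : measurable_fun [set: borel X] (a g : borel X -> borel X).
Proof.
apply: (@measurability _ _ (borel X) (borel X) setT (a g) (@open X) erefl) => _ [U oU <-]; rewrite setTI.
by apply: sub_sigma_algebra; move/continuousP: (act_continuous (g := g)); apply.
Qed.

(** The mean is integration against the invariant measure. Only these three properties are kept, so
    that no measure theory enters the argument below. *)
Lemma amenable_mean : exists I : (X -> R) -> R, [/\
  (forall f h, continuous f -> continuous h -> I (fun x => f x + h x) = I f + I h),
  (forall f c, continuous f -> (forall x, c <= f x) -> c <= I f) &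
  (forall g f, continuous f -> I (fun x => f (a g x)) = I f)].
Proof.
have [mu [_ muP]] := amG cptX T2X aP ac.
exists (fun f => \int[mu]_(x in [set: borel X]) f x)%R.
have intf (f : X -> R) : continuous f -> mu.-integrable [set: borel X] (EFin \o f).
  move=> cf; apply: measurable_bounded_integrable => //.
  - by rewrite -ge0_fin_numE// fin_num_measure.
  - exact: borel_continuous.
  - have : compact (f @` [set: X]).
      by apply: continuous_compact => //; exact: continuous_subspaceT.
    move=> /compact_bounded[M [Mr fM]]; exists M; split=> // N /fM fN x _.
    by apply: fN; exists x.
split.
- by move=> f h cf ch; rewrite RintegralD//; exact: intf.
- move=> f c cf cle; have := Rintegral_cst mu (@measurableT _ (borel X)) c.
  rewrite [X in fine X](@probability_setT _ _ _ mu) mulr1 => <-.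
  by apply: le_Rintegral => //; [apply: intf => x; exact: cvg_cst|exact: intf].
- move=> g f cf; rewrite /Rintegral; congr fine.
  have mg := borel_act g.
  rewrite -[LHS](integral_pushforward mg (mu := mu) (D := setT) (f := EFin \o f))//.
  - by apply: eq_measure_integral => A mA _; exact: muP.
  - by apply/measurable_EFinP; exact: borel_continuous.
  - apply: intf => x; apply: continuous_comp; last exact: cf.
    exact: act_continuous.
Qed.
End Mean.

(** * Means on bounded functions *)

Section BoundedFunctions.
Variables (R : realType) (Y : Type).

Definition bdd_pred : {pred Y -> R} :=
  fun f => `[< exists M, forall y, `|f y| <= M >].

Lemma bdd_submod : submod_closed bdd_pred.
Proof.
split; first by apply/asboolP; exists 0 => y; rewrite normr0.
move=> a f h /asboolP[M fM] /asboolP[N hN]; apply/asboolP.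
exists (`|a| * M + N) => y; rewrite (le_trans (ler_normD _ _))// lerD//.
by rewrite normrM ler_wpM2l.
Qed.

HB.instance Definition _ :=
  GRing.isSubmodClosed.Build R (Y -> R) bdd_pred bdd_submod.

Definition bddfun := {f : Y -> R | bdd_pred f}.
HB.instance Definition _ := SubChoice.on bddfun.
HB.instance Definition _ := [SubChoice_isSubLmodule of bddfun by <:].

End BoundedFunctions.

(** This is [mazur_orlicz] for the supremum functional and the cone spanned by the pairs [(c i, e)];
    the hypothesis makes the supremum dominate this cone. A point [y] that depends on the weights is
    exchanged for one mean that serves every [i]. *)
Lemma bounded_mean (R : realType) (Y I : Type) (c : I -> bddfun R Y) (e : R) :
    (forall s : seq (R * I), all (fun x => 0 <= x.1) s ->
      exists y, e * (\sum_(x <- s) x.1) <= \sum_(x <- s) x.1 * \val (c x.2) y) ->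
  exists m : bddfun R Y -> R, [/\ linear m,
    forall f M, (forall y, \val f y <= M) -> m f <= M &
    forall i, e <= m (c i)].
Proof.
move=> cP.
(* The empty list of weights shows that [Y] is inhabited, so that suprema over it are meaningful. *)
have [y0 _] : exists y : Y, True by have [|y _] := cP [::]; [|exists y].
pose p (f : bddfun R Y) := sup (range (\val f)).
have p_le (f : bddfun R Y) M : (forall y, \val f y <= M) -> p f <= M.
  move=> fM; apply: ge_sup; first by exists (\val f y0), y0.
  by move=> _ [y _ <-].
have le_p (f : bddfun R Y) y : \val f y <= p f.
  apply: ub_le_sup; last by exists y.
  have /asboolP[M fM] := valP f; exists M => _ [z _ <-].
  by rewrite (le_trans (ler_norm _)).
have pZ t f : 0 < t -> p (t *: f) <= t * p f.
  move=> t0; apply: (p_le) => y.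
  by rewrite [leLHS](_ : _ = t * \val f y)// ler_pM2l.
have ps : sublinear p.
  split=> [f h|t f]; first by apply: (p_le) => y; rewrite lerD.
  rewrite le_eqVlt => /predU1P[<-|t0].
    rewrite scale0r mul0r; apply/eqP; rewrite eq_le p_le//=.
    exact: (le_p 0 y0).
  apply/eqP; rewrite eq_le pZ//= -ler_pdivlMl//.
  by rewrite -[f in leLHS](scalerK (lt0r_neq0 t0)) pZ// invr_gt0.
pose C (f : bddfun R Y) (t : R) := exists s : seq (R * I),
  [/\ all (fun x => 0 <= x.1) s, f = \sum_(x <- s) x.1 *: c x.2 &
      t = e * \sum_(x <- s) x.1].
have CC : convex_cone C.
  split=> [|f t f' t' [s [s0 -> ->]] [s' [s'0 -> ->]]|b f t b0 [s [s0 -> ->]]].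
  - by exists [::]; rewrite !big_nil mulr0.
  - by exists (s ++ s'); rewrite all_cat s0 s'0 !big_cat mulrDr.
  - exists [seq (b * x.1, x.2) | x <- s]; split.
    + by rewrite all_map; apply: sub_all s0 => x /= /(mulr_ge0 b0).
    + by rewrite big_map scaler_sumr; apply: eq_bigr => x _ /=; rewrite scalerA.
    + by rewrite big_map/= -mulr_sumr mulrCA.
have [|m [ml mp mC]] := mazur_orlicz ps CC.
  move=> f t [s [s0 -> ->]]; have [y] := cP s s0.
  move/le_trans; apply; apply: le_trans (le_p _ y).
  have -> : \val (\sum_(x <- s) x.1 *: c x.2) y = \sum_(x <- s) x.1 * \val (c x.2) y.
    by elim/big_rec2: _ => //= x a b _ <-.
  by [].
exists m; split=> // [f M fM|i]; first by rewrite (le_trans (mp _))// p_le.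
apply: mC; exists [:: (1, i)].
by rewrite !big_seq1 scale1r mulr1 /= ler01.
Qed.

(** * Compactness and continuity for spaces of functions *)

Section SubspaceTopology.
Variables (T : topologicalType) (A : set T).

Lemma compact_set_type : compact A -> compact [set: set_type A].
Proof.
move=> Ac F FF _.
have [|t [At tF]] := Ac (set_val @ F) (fmap_proper_filter _ FF).
  change (F (set_val @^-1` A)); by apply: (filterS _ filterT) => x _; exact: set_valP.
exists (SigSub (mem_set At)); split=> // B N FB.
rewrite nbhsE => -[_ [[W oW <-] /= Wt] WN].
have [|_ [[x Bx <-] Wx]] := tF (set_val @` B) W _ (open_nbhs_nbhs (conj oW Wt)).
  change (F (set_val @^-1` (set_val @` B))).
  by apply: filterS FB => x Bx; exists x.
by exists x; split=> //; exact: WN.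
Qed.

Lemma hausdorff_set_type : hausdorff_space T -> hausdorff_space (set_type A).
Proof.
rewrite !open_hausdorff => T2 x y xy.
have [|[U V] /= [xU yV] [oU oV UV]] := T2 (set_val x) (set_val y).
  by apply: contra_neq xy => /val_inj.
exists (set_val @^-1` U, set_val @^-1` V) => /=; first by rewrite !inE in xU yV *.
split; [by exists U|by exists V|].
apply/eqP; rewrite -subset0 => z [/= zU zV].
suff : (U `&` V) (set_val z) by rewrite (eqP UV).
by split.
Qed.

End SubspaceTopology.

Lemma closed_forall (T : topologicalType) (I : Type) (F : I -> set T) :
  (forall i, closed (F i)) -> closed [set x | forall i, F i x].
Proof.
move=> Fc; rewrite (_ : [set x | _] = \bigcap_i F i); first exact: closed_bigI.
by apply/seteqP; split=> x Fx; [move=> i _; exact: Fx|move=> i; exact: Fx].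
Qed.

Lemma closed_continuous_le (R : realType) (T : topologicalType) (f : T -> R) (c : R) :
  continuous f -> closed [set x | f x <= c].
Proof. by move=> cf; apply: (preimage_closed (D := [set y | y <= c])). Qed.

Lemma continuous_normr (R : realType) (T : topologicalType) (f : T -> R) :
  continuous f -> continuous (fun x => `|f x|).
Proof. by move=> cf x; apply: cvg_norm; exact: cf. Qed.

Lemma continuous_oppr (R : realType) (T : topologicalType) (f : T -> R) :
  continuous f -> continuous (fun x => - f x).
Proof. by move=> cf x; apply: cvgN; exact: cf. Qed.

Lemma continuous_sub (R : realType) (T : topologicalType) (f h : T -> R) :
  continuous f -> continuous h -> continuous (fun x => f x - h x).
Proof. by move=> cf ch x; apply: cvgB; [exact: cf|exact: ch]. Qed.

Lemma continuous_sum (R : realType) (T : topologicalType) (I : Type) (r : seq I)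
    (f : I -> T -> R) :
  (forall i, continuous (f i)) -> continuous (fun x => \sum_(i <- r) f i x).
Proof.
move=> cf; elim: r => [|i r IH].
  by under eq_fun do rewrite big_nil; move=> x; exact: cvg_cst.
under eq_fun do rewrite big_cons.
by move=> x; apply: cvgD; [exact: cf|exact: IH].
Qed.

Lemma continuous_ptws (R : realType) (I : eqType) (T : topologicalType)
    (f : T -> {ptws I -> R}) :
  (forall i, continuous (fun x => f x i)) -> continuous f.
Proof.
move=> cf x; apply/cvg_sup => i.
exact: (@continuous_comp_initial _ _ _ (fun w : {ptws I -> R} => w i) f (cf i)).
Qed.

Section Reiter.
Variables (R : realType) (G : topGroupType) (U : Type) (u : U -> G -> R).
Hypotheses (amG : amenable R G) (u1 : forall i h, `|u i h| <= 1)
  (ucont : forall e : R, 0 < e -> nbhs (1%g : G)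
    [set k | forall i h l, `|u i (h * k * l)%g - u i (h * l)%g| <= e]).

(* Otherwise some mean on [G] moves by at least [e]; it gives a point of the compact
   [G]-space [P] of functions on ['I_n * G] with drift at least [e], on which the
   action is jointly continuous by equicontinuity, and an invariant probability
   measure on [P] makes the average drift vanish. *)
Lemma reiter (n : nat) (g : 'I_n -> G) (e : R) : 0 < e ->
  exists s : seq (R * G), [/\ all (fun x => 0 <= x.1) s, \sum_(x <- s) x.1 = 1 &
    forall j i, \sum_(x <- s) x.1 * (u i (g j * x.2)%g - u i x.2) <= e].
Proof.
move=> e0; apply: contrapT => nos.
have nos' (s : seq (R * G)) : all (fun x => 0 <= x.1) s -> \sum_(x <- s) x.1 = 1 ->
    exists y : 'I_n * U, e <= \sum_(x <- s) x.1 * (u y.2 (g y.1 * x.2)%g - u y.2 x.2).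
  move=> s0 s1; apply: contrapT => noy; apply: nos; exists s; split=> // j i.
  by rewrite leNgt; apply/negP => /ltW eji; apply: noy; exists (j, i).
pose I := ('I_n * G)%type.
(* The mean will live on the pairs [(j, i)] of an index and a test. Cutting off at [j] separates the
   elements [g j]: the value of [c h] at [(j, i)] is the drift of the test [i] under [g j] at
   [h]. *)
pose ub (j : 'I_n) (h : G) : 'I_n * U -> R := fun y => (y.1 == j)%:R * u y.2 h.
have ub_bounded j h : bdd_pred (ub j h).
  apply/asboolP; exists 1 => -[j' i]; rewrite /ub normrM.
  by case: eqVneq => _; rewrite ?normr1 ?mul1r// normr0 mul0r.
pose b j h : bddfun R ('I_n * U) := Sub (ub j h) (ub_bounded j h).
pose c (h : G) : bddfun R ('I_n * U) := \sum_j (b j (g j * h)%g - b j h).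
have cE h y : \val (c h) y = u y.2 (g y.1 * h)%g - u y.2 h.
  transitivity (\sum_j (ub j (g j * h)%g y - ub j h y)).
    by rewrite /c; elim/big_rec2: _ => //= j x z _ <-.
  rewrite (bigD1 y.1)//= big1 ?addr0 => [|j jy]; first by rewrite /ub eqxx !mul1r.
  by rewrite /ub eq_sym (negPf jy) !mul0r subrr.
have [|m [ml mle mc]] := bounded_mean (c := c) (e := e).
  move=> s s0; under eq_exists => y do under [leRHS]eq_bigr do rewrite cE.
  have s_ge0 : 0 <= \sum_(x <- s) x.1.
    by rewrite big_seq; apply: sumr_ge0 => x xs; move/allP: s0; exact.
  (* If the total weight is zero, all weights vanish and any pair will do; the point mass at [1]
     supplies one. *)
  have [sum0|] := eqVneq (\sum_(x <- s) x.1) 0.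
    have [||y _] := nos' [:: (1, 1%g)]; rewrite ?big_seq1//= ?ler01//.
    exists y; rewrite sum0 mulr0 big_seq big1//= => x xs.
    have : \sum_(x <- s | x \in s) x.1 == 0 by rewrite -big_seq sum0.
    rewrite psumr_eq0 => [|z zs]; last by move/allP: s0; exact.
    by move=> /allP/(_ _ xs)/implyP/(_ xs)/eqP ->; rewrite mul0r.
  set W := \sum_(x <- s) x.1 => W_neq0.
  have W0 : 0 < W by rewrite lt_def W_neq0.
  have [||y ey] := nos' [seq (W^-1 * x.1, x.2) | x <- s].
  - by rewrite all_map; apply: sub_all s0 => x /= x0; rewrite mulr_ge0// invr_ge0 ltW.
  - by rewrite big_map/= -mulr_sumr mulVf.
  exists y; rewrite mulrC -ler_pdivlMl// (le_trans ey)// big_map/= mulr_sumr.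
  by apply: ler_sum => x _; rewrite mulrA.
have mB f h : m (f - h) = m f - m h.
  by rewrite addrC -scaleN1r ml addrC scaleN1r.
have mabs f M : (forall y, `|\val f y| <= M) -> `|m f| <= M.
  move=> fM; rewrite ler_norml; apply/andP; split; last first.
    by apply: mle => y; rewrite (le_trans (ler_norm _)).
  rewrite lerNl -[- _]sub0r -(subrr (m 0)) -!mB subrr sub0r.
  apply: mle => y; rewrite (le_trans (ler_norm _))//.
  by rewrite (_ : \val (- f) y = - \val f y)// normrN.
(* The bound makes [P] compact, the common modulus of continuity makes the action continuous, and
   the last condition is a drift of at least [e] at every [h]. All three survive pointwise limits
   and right translation. *)
pose P : set {ptws I -> R} := [set w |
  [/\ forall x, `|w x| <= 1,
      forall k (d : R), (forall i h l, `|u i (h * k * l)%g - u i (h * l)%g| <= d) ->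
        forall j h l, `|w (j, (h * k * l)%g) - w (j, (h * l)%g)| <= d &
      forall h, e <= \sum_j (w (j, (g j * h)%g) - w (j, h))]].
have evc (x : I) : continuous (fun w : {ptws I -> R} => w x).
  exact: (@proj_continuous I (fun=> R) x).
have Pclosed : closed P.
  rewrite (_ : P = [set w | forall x, `|w x| <= 1] `&` ([set w | forall k (d : R),
      (forall i h l, `|u i (h * k * l)%g - u i (h * l)%g| <= d) ->
        forall j h l, `|w (j, (h * k * l)%g) - w (j, (h * l)%g)| <= d] `&`
      [set w | forall h, - (\sum_j (w (j, (g j * h)%g) - w (j, h))) <= - e])); last first.
    apply/seteqP; split=> w; first by case=> ? ? we; do !split=> //; move=> h; rewrite lerN2.
    by case=> ? [? we]; split=> // h; have := we h; rewrite lerN2.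
  apply: closedI; last apply: closedI.
  - apply: closed_forall => x; apply: closed_continuous_le.
    exact: continuous_normr (evc x).
  - do 3!apply: closed_forall => ?.
    do 3!apply: closed_forall => ?; apply: closed_continuous_le.
    exact: continuous_normr (continuous_sub (evc _) (evc _)).
  - apply: closed_forall => h; apply: closed_continuous_le.
    apply: continuous_oppr; apply: continuous_sum => j.
    exact: continuous_sub (evc _) (evc _).
have Pcompact : compact P.
  apply: (subclosed_compact Pclosed (@tychonoff I _ _ (fun=> @segment_compact R (-1) 1))).
  by move=> w [w1 _ _] x; rewrite /= in_itv/= -ler_norml.
have P0 : P (fun x => m (b x.1 x.2)).
  split=> [x|k d kd j h l|h] /=.
  - apply: mabs => y /=; rewrite /ub normrM.
    by case: eqVneq => _; rewrite ?normr1 ?mul1r// normr0 mul0r.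
  - rewrite -mB; apply: mabs => y /=.
    rewrite [X in `|X|](_ : _ = ub j (h * k * l)%g y - ub j (h * l)%g y)//.
    rewrite /ub -mulrBr normrM.
    by case: eqVneq => _; rewrite ?normr1 ?mul1r// normr0 mul0r (le_trans _ (kd y.2 h l)).
  - rewrite (le_trans (mc h))// /c.
    under [leRHS]eq_bigr do rewrite -mB.
    rewrite le_eqVlt; apply/orP; left; apply/eqP.
    have m0 : m 0 = 0 by rewrite -(subrr 0) mB subrr.
    have mD f f' : m (f + f') = m f + m f' by rewrite -{1}[f']opprK mB -[- f']sub0r mB m0 sub0r opprK.
    exact: (big_morph m mD m0).
pose X := HB.pack_for ptopologicalType (set_type P) (isPointed.Build (set_type P) (SigSub (mem_set P0))).
(* Right translation commutes with the left multiplications by [g j] and so preserves the drift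
   condition. *)
pose aval (k : G) (w : I -> R) : {ptws I -> R} := fun x => w (x.1, x.2 * k)%g.
have aP k w : P w -> P (aval k w).
  move=> [w1 wc we]; split=> [x|k' d kd j h l|h] /=; first exact: w1.
    by have := wc _ _ kd j h (l * k)%g; rewrite /aval/= !mulgA.
  by rewrite (le_trans (we (h * k)%g))//; apply: ler_sum => j _; rewrite mulgA.
pose a (k : G) (w : X) : X := SigSub (mem_set (aP k _ (set_valP w))).
have valc x : continuous (fun w : X => set_val w x).
  move=> w; apply: (@continuous_comp _ _ _ (set_val : X -> {ptws I -> R}) (fun w => w x)).
    exact: initial_continuous.
  exact: evc.
have [] := @amenable_mean R G X a amG.
- exact: compact_set_type.
- by apply: hausdorff_set_type; apply: hausdorff_product => x; exact: Rhausdorff.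
- split=> [w|k l w]; apply/val_inj/funext => -[j h] /=; rewrite /aval/=.
    by rewrite mulg1.
  by rewrite mulgA.
- apply: (@continuous_comp_initial _ _ _ (set_val : set_type P -> {ptws I -> R})).
  apply: continuous_ptws => -[j h] [k w] /=; rewrite /aval/=.
  apply/cvgrPdist_le => d d0.
  have d20 : 0 < d / 2 by rewrite divr_gt0.
  have nk : \forall k' \near k, forall i h l,
      `|u i (h * (k^-1 * k') * l)%g - u i (h * l)%g| <= d / 2.
    have /(_ k) : continuous (fun k' : G => (k^-1 * k')%g).
      move=> k'; apply: (@continuous_comp _ _ _ (fun y => (k^-1, y)%g)
        (fun p : G * G => (p.1 * p.2)%g)); last exact: mulg_continuous.
      by apply: cvg_pair => //=; exact: cvg_cst.
    by move=> /(_ _); rewrite /continuous_at mulVg => /(_ _ (ucont d20)).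
  have nw : \forall w' \near w,
      `|set_val w (j, (h * k)%g) - set_val w' (j, (h * k)%g)| <= d / 2.
    by have /cvgrPdist_le/(_ _ d20) := valc (j, (h * k)%g) w.
  exists ([set k' | forall i h l, `|u i (h * (k^-1 * k') * l)%g - u i (h * l)%g| <= d / 2],
          [set w' | `|set_val w (j, (h * k)%g) - set_val w' (j, (h * k)%g)| <= d / 2]) => //.
  move=> [k' w'] /= [kk' ww'].
  (* First [w] is changed to [w'], then [k] to [k' = k * (k^-1 * k')]; the common modulus of
     continuity bounds the second error uniformly in [w']. *)
  rewrite -(subrKA (set_val w' (j, (h * k)%g))) (le_trans (ler_normD _ _))//.
  rewrite (splitr d) lerD//.
  have [_ wc _] := set_valP w'; rewrite distrC.
  have := wc _ _ kk' j (h * k)%g 1%g.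
  by rewrite !mulg1 -!mulgA mulVKg.
move=> J [JD Jge Ja].
have J0 : J (fun=> 0) = 0.
  have c0 : continuous (fun _ : X => 0 : R).
    by have := continuous_sum (r := [::]) valc; under eq_fun do rewrite big_nil.
  have := JD _ _ c0 c0; under eq_fun do rewrite addr0.
  by lra.
have Jsum (r : seq 'I_n) :
    J (fun w => \sum_(j <- r) (set_val w (j, g j) - set_val w (j, 1%g))) = 0.
  elim: r => [|j r IH]; first by under eq_fun do rewrite big_nil.
  under eq_fun do rewrite big_cons.
  have cj : continuous (fun w : X => set_val w (j, g j) - set_val w (j, 1%g)).
    exact: continuous_sub (valc _) (valc _).
  have cr : continuous (fun w : X =>
      \sum_(j <- r) (set_val w (j, g j) - set_val w (j, 1%g))).
    by apply: continuous_sum => i; exact: continuous_sub (valc _) (valc _).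
  rewrite JD// IH addr0; have := JD _ _ cj (valc (j, 1%g)).
  under eq_fun do rewrite subrK.
  (* The action of [g j] turns evaluation at [(j, 1)] into evaluation at [(j, g j)]. *)
  have -> : J (fun w : X => set_val w (j, g j)) = J (fun w : X => set_val w (j, 1%g)).
    rewrite -[RHS](Ja (g j))//; congr J; apply/funext => w.
    by rewrite -{1}(mul1g (g j)).
  by lra.
have : e <= 0.
  rewrite -(Jsum (index_enum 'I_n)); apply: Jge.
    by apply: continuous_sum => j; exact: continuous_sub (valc _) (valc _).
  move=> w; have [_ _ we] := set_valP w.
  rewrite (le_trans (we 1%g))//; apply: ler_sum => j _.
  by rewrite mulg1.
by rewrite leNgt e0.
Qed.

End Reiter.

(** * Orthonormal families and the spectral theorem *)

Section ComplexModulus.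
Variable R : realType.
Implicit Types z : R[i].

Definition csq z : R := complex.Re z ^+ 2 + complex.Im z ^+ 2.

Lemma csqE z : (csq z)%:C = `|z| ^+ 2.
Proof. exact: add_Re2_Im2. Qed.

Lemma csq_ge0 z : 0 <= csq z.
Proof. by rewrite addr_ge0// sqr_ge0. Qed.

Lemma csq0 : csq (0 : R[i]) = 0.
Proof. by apply: complexI; rewrite csqE normr0 expr0n. Qed.

Lemma Re_sum (I : Type) (r : seq I) (P : pred I) (F : I -> R[i]) :
  complex.Re (\sum_(i <- r | P i) F i) = \sum_(i <- r | P i) complex.Re (F i).
Proof. by apply: (big_morph (@complex.Re R)) => [[a b] [c d]|]. Qed.

Lemma real_sum (I : Type) (r : seq I) (P : pred I) (F : I -> R) :
  (\sum_(i <- r | P i) F i)%:C = \sum_(i <- r | P i) (F i)%:C.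
Proof. exact: raddf_sum. Qed.

Lemma ReM_real (a : R) z : complex.Re (a%:C * z) = a * complex.Re z.
Proof. by case: z => x y /=; rewrite mul0r subr0. Qed.

Lemma Re_conj z : complex.Re (Num.conj z) = complex.Re z.
Proof. by case: z. Qed.

Lemma csq_conj z : csq (Num.conj z) = csq z.
Proof. by case: z => a b; rewrite /csq /= sqrrN. Qed.

Lemma ReD z z' : complex.Re (z + z') = complex.Re z + complex.Re z'.
Proof. by case: z z' => [? ?] [? ?]. Qed.

Lemma ReN z : complex.Re (- z) = - complex.Re z.
Proof. by case: z. Qed.

End ComplexModulus.

Section InnerProduct.
Variables (R : realType) (V : hilbertType R).
Implicit Types (x y z : V) (a : R[i]).

Lemma innerC x y : inner x y = Num.conj (inner y x).
Proof. by rewrite hermC expr0 mul1r. Qed.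

Lemma innerDl x y z : inner (x + y) z = inner x z + inner y z.
Proof. exact: linearDl. Qed.

Lemma innerDr x y z : inner z (x + y) = inner z x + inner z y.
Proof. exact: linearDr. Qed.

Lemma innerNl x z : inner (- x) z = - inner x z.
Proof. exact: linearNl. Qed.

Lemma innerNr x z : inner z (- x) = - inner z x.
Proof. exact: linearNr. Qed.

Lemma innerBl x y z : inner (x - y) z = inner x z - inner y z.
Proof. by rewrite innerDl innerNl. Qed.

Lemma innerBr x y z : inner z (x - y) = inner z x - inner z y.
Proof. by rewrite innerDr innerNr. Qed.

Lemma innerZl a x z : inner (a *: x) z = a * inner x z.
Proof. exact: linearZl_LR. Qed.

Lemma innerZr a x z : inner z (a *: x) = Num.conj a * inner z x.
Proof. exact: linearZr_LR. Qed.

Lemma inner_suml (I : Type) (r : seq I) (P : pred I) (F : I -> V) z :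
  inner (\sum_(i <- r | P i) F i) z = \sum_(i <- r | P i) inner (F i) z.
Proof. exact: linear_sumlz. Qed.

Lemma inner_sumr (I : Type) (r : seq I) (P : pred I) (F : I -> V) z :
  inner z (\sum_(i <- r | P i) F i) = \sum_(i <- r | P i) inner z (F i).
Proof. exact: linear_sumr. Qed.

(** Real-valued, whereas the norm of [V] takes its values in [R[i]]: sums, suprema and linear
    arithmetic then take place in [R]. *)
Definition nsq x : R := complex.Re (inner x x).

Lemma nsqE x : inner x x = (nsq x)%:C.
Proof. by rewrite /nsq RRe_real// ger0_real// dnorm_ge0. Qed.

Lemma norm_nsq x : `|x| ^+ 2 = (nsq x)%:C.
Proof. by rewrite inner_norm nsqE. Qed.

Lemma nsq_ge0 x : 0 <= nsq x.
Proof. by rewrite -ler0c -nsqE dnorm_ge0. Qed.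

Lemma nsq_eq0 x : (nsq x == 0) = (x == 0).
Proof. by rewrite -(dnorm_eq0 inner x) nsqE -(inj_eq (@complexI R)). Qed.

Lemma nsq0 : nsq 0 = 0.
Proof. by apply/eqP; rewrite nsq_eq0. Qed.

Lemma nsqZ a x : nsq (a *: x) = csq a * nsq x.
Proof.
apply: complexI; rewrite -nsqE innerZl innerZr mulrA nsqE -normCK -csqE.
by rewrite rmorphM.
Qed.

Lemma nsqN x : nsq (- x) = nsq x.
Proof. by rewrite /nsq innerNl innerNr opprK. Qed.

Lemma nsqD x y : nsq (x + y) = nsq x + nsq y + 2 * complex.Re (inner x y).
Proof.
rewrite /nsq innerDl !innerDr !ReD (innerC y x) Re_conj; lra.
Qed.

Lemma nsqB x y : nsq (x - y) = nsq x + nsq y - 2 * complex.Re (inner x y).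
Proof. by rewrite nsqD nsqN innerNr ReN mulrN. Qed.

Lemma parallelogram x y : nsq (x + y) + nsq (x - y) = 2 * nsq x + 2 * nsq y.
Proof. by rewrite nsqD nsqB; lra. Qed.

Lemma norm_lt_nsq x (e : R) : 0 <= e -> (`|x| < e%:C) = (nsq x < e ^+ 2).
Proof.
move=> e0; rewrite -ltcR -norm_nsq rmorphXn ltr_pXn2r// ?nnegrE//.
by rewrite ler0c.
Qed.

Lemma norm1_nsq x : (`|x| = 1) <-> (nsq x = 1).
Proof.
split=> [x1|x1].
  by apply: complexI; rewrite -norm_nsq x1 expr1n.
by apply/eqP; rewrite -(@eqrXn2 _ 2)// norm_nsq x1 expr1n.
Qed.

End InnerProduct.

Section LinearPredicate.
Variables (K : pzRingType) (U V : lmodType K) (T : U -> V).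
Hypothesis Tl : linear T.

Lemma lin_0 : T 0 = 0.
Proof. by have := Tl (-1) 0 0; rewrite scaler0 addr0 scaleN1r addNr. Qed.

Lemma lin_Z a x : T (a *: x) = a *: T x.
Proof. by have := Tl a x 0; rewrite lin_0 !addr0. Qed.

Lemma lin_D x y : T (x + y) = T x + T y.
Proof. by have := Tl 1 x y; rewrite !scale1r. Qed.

Lemma lin_B x y : T (x - y) = T x - T y.
Proof. by rewrite lin_D -scaleN1r lin_Z scaleN1r. Qed.

Lemma lin_comb (I : Type) (r : seq I) (c : I -> K) (x : I -> U) :
  T (\sum_(i <- r) c i *: x i) = \sum_(i <- r) c i *: T (x i).
Proof. by elim/big_rec2: _ => [|i _ y _ <-]; rewrite ?lin_0// Tl. Qed.

End LinearPredicate.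

Section Orthonormal.
Variables (R : realType) (V : hilbertType R).
Implicit Types (x y z : V).

Definition orthonormal_fam n (h : 'I_n -> V) :=
  forall i j, inner (h i) (h j) = (i == j)%:R.

Definition proj_fam n (h : 'I_n -> V) x := \sum_i inner x (h i) *: h i.

Lemma sum_delta n (F : 'I_n -> R[i]) k : \sum_i F i * (i == k)%:R = F k.
Proof.
rewrite (bigD1 k)//= eqxx mulr1 big1 ?addr0// => i /negPf ->.
by rewrite mulr0.
Qed.

Lemma proj_fam_linear n (h : 'I_n -> V) : linear (proj_fam h).
Proof.
move=> a x y; rewrite /proj_fam scaler_sumr -big_split; apply: eq_bigr => j _.
by rewrite innerDl innerZl scalerDl scalerA.
Qed.

Section Family.
Variables (n : nat) (h : 'I_n -> V).
Hypothesis ho : orthonormal_fam h.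

Lemma nsq_sum_fam (c : 'I_n -> R[i]) : nsq (\sum_i c i *: h i) = \sum_i csq (c i).
Proof.
apply: complexI; rewrite -nsqE inner_suml real_sum; apply: eq_bigr => i _.
rewrite innerZl inner_sumr; under eq_bigr do rewrite innerZr ho eq_sym.
by rewrite sum_delta csqE normCK.
Qed.

Lemma inner_proj_fam x y : inner (proj_fam h x) y = inner x (proj_fam h y).
Proof.
rewrite inner_suml inner_sumr; apply: eq_bigr => i _.
by rewrite innerZl innerZr -innerC mulrC.
Qed.

Lemma proj_fam_h i : proj_fam h (h i) = h i.
Proof.
rewrite /proj_fam (bigD1 i)//= ho eqxx scale1r big1 ?addr0// => j ji.
by rewrite ho eq_sym (negPf ji) scale0r.
Qed.

Lemma inner_proj_fam_h x i : inner (proj_fam h x) (h i) = inner x (h i).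
Proof. by rewrite inner_proj_fam proj_fam_h. Qed.

Lemma proj_famK x : proj_fam h (proj_fam h x) = proj_fam h x.
Proof. by apply: eq_bigr => i _; rewrite inner_proj_fam_h. Qed.

Lemma nsq_proj_fam x : nsq x = nsq (x - proj_fam h x) + \sum_i csq (inner x (h i)).
Proof.
rewrite -nsq_sum_fam -/(proj_fam h x).
have := nsqD (x - proj_fam h x) (proj_fam h x); rewrite subrK => ->.
rewrite innerBl (_ : inner x (proj_fam h x) = inner (proj_fam h x) (proj_fam h x)).
  by rewrite subrr mulr0 addr0.
by rewrite inner_proj_fam proj_famK.
Qed.

Lemma bessel x : \sum_i csq (inner x (h i)) <= nsq x.
Proof. by rewrite [leRHS]nsq_proj_fam lerDr nsq_ge0. Qed.

Definition fam_cons (e : V) (i : 'I_n.+1) : V :=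
  if unlift ord0 i is Some j then h j else e.

Lemma fam_cons_orthonormal e : nsq e = 1 -> (forall i, inner e (h i) = 0) ->
  orthonormal_fam (fam_cons e).
Proof.
move=> e1 eh i j; rewrite /fam_cons.
case: unliftP => [i' ->|->]; case: unliftP => [j' ->|->].
- by rewrite ho (inj_eq lift_inj).
- by rewrite innerC eh conjC0 eq_sym (negPf (neq_lift _ _)).
- by rewrite eh (negPf (neq_lift _ _)).
- by rewrite nsqE e1 eqxx.
Qed.

Lemma fam_cons_sum (T : nmodType) e (F : V -> T) :
  \sum_i F (fam_cons e i) = F e + \sum_i F (h i).
Proof.
rewrite big_ord_recl /fam_cons unlift_none; congr +%R.
by apply: eq_bigr => i _; rewrite liftK.
Qed.

End Family.

Lemma normalize x : x != 0 -> exists2 a : R[i], nsq (a *: x) = 1 & x = a^-1 *: (a *: x).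
Proof.
move=> x0; have nx : 0 < nsq x by rewrite lt_def nsq_eq0 x0 nsq_ge0.
exists ((Num.sqrt (nsq x))^-1)%:C.
  rewrite nsqZ /csq /= expr0n addr0 exprVn sqr_sqrtr ?ltW// mulVf//.
  by rewrite gt_eqF.
rewrite scalerA mulVf ?scale1r// -[0]/(0%:C) (inj_eq (@complexI R)) invr_eq0.
by rewrite gt_eqF// sqrtr_gt0.
Qed.

Lemma gram_schmidt (s : seq V) : exists n (h : 'I_n -> V),
  orthonormal_fam h /\ forall x, x \in s -> proj_fam h x = x.
Proof.
elim: s => [|x s [n [h [ho hs]]]].
  by exists 0%N, (fun=> 0); split=> // -[].
have [x0|x0] := eqVneq (x - proj_fam h x) 0.
  exists n, h; split=> // y; rewrite inE => /predU1P[->|/hs//].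
  by apply/esym/eqP; rewrite -subr_eq0 x0.
have [a a1 xa] := normalize x0.
set e := a *: _ in a1 xa.
have eh i : inner e (h i) = 0.
  by rewrite /e innerZl innerBl inner_proj_fam_h// subrr mulr0.
exists n.+1, (fam_cons h e); split; first exact: fam_cons_orthonormal.
move=> y; rewrite inE /proj_fam (fam_cons_sum h e (fun k => inner y k *: k)) -/(proj_fam h y).
case/predU1P => [->|ys]; last first.
  rewrite hs// -[y in inner y e](hs _ ys) inner_proj_fam//.
  by rewrite /proj_fam big1 ?linear0r ?scale0r ?add0r// => i _; rewrite eh scale0r.
rewrite -[RHS](subrK (proj_fam h x)); congr +%R; rewrite [RHS]xa; congr (_ *: _).
rewrite -[x in LHS](subrK (proj_fam h x)) innerDl [X in _ + X](_ : _ = 0) ?addr0.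
  by rewrite xa innerZl nsqE a1 mulr1.
rewrite inner_proj_fam// (_ : proj_fam h e = 0) ?linear0r//.
by rewrite /proj_fam big1// => i _; rewrite eh scale0r.
Qed.

(* Expand [0 <= \sum_l |T k_l - \sum_i conj <h_i, k_l> T h_i|^2]. *)
Lemma energy_le m n (h : 'I_m -> V) (k : 'I_n -> V) (T : V -> V) :
  linear T -> orthonormal_fam h -> orthonormal_fam k ->
  (forall i, proj_fam k (h i) = h i) ->
  \sum_i nsq (T (h i)) <= \sum_l nsq (T (k l)).
Proof.
move=> Tl ho ko kh.
have Th i : T (h i) = \sum_l inner (h i) (k l) *: T (k l).
  by rewrite -{1}(kh i) lin_comb.
pose z l := \sum_i Num.conj (inner (h i) (k l)) *: T (h i).
(* The cross term and the square both equal the energy of [h], so the expanded sum is the energy of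
   [k] minus that of [h]. *)
have cross : \sum_l complex.Re (inner (T (k l)) (z l)) = \sum_i nsq (T (h i)).
  rewrite -Re_sum; under eq_bigr do rewrite inner_sumr.
  rewrite exchange_big/= Re_sum; apply: eq_bigr => i _.
  rewrite /nsq {2}Th inner_suml; congr complex.Re; apply: eq_bigr => l _.
  by rewrite innerZr innerZl conjCK.
have square : \sum_l nsq (z l) = \sum_i nsq (T (h i)).
  apply: complexI; rewrite !real_sum; under eq_bigr do rewrite -nsqE inner_suml.
  rewrite exchange_big/=; apply: eq_bigr => i _.
  under eq_bigr do rewrite inner_sumr.
  rewrite exchange_big/= -nsqE.
  transitivity (\sum_j inner (T (h i)) (T (h j)) * (j == i)%:R); last first.
    by rewrite sum_delta.
  apply: eq_bigr => j _.
  have -> : (j == i)%:R = \sum_l inner (h j) (k l) * Num.conj (inner (h i) (k l)).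
    rewrite -ho -{1}(kh j) inner_suml.
    by apply: eq_bigr => l _; rewrite innerZl (innerC (k l)).
  rewrite mulr_sumr; apply: eq_bigr => l _; rewrite innerZl innerZr conjCK.
  by rewrite mulrC -mulrA mulrCA mulrA.
have : 0 <= \sum_l nsq (T (k l) - z l).
  by apply: sumr_ge0 => l _; exact: nsq_ge0.
under eq_bigr do rewrite nsqB.
rewrite sumrB big_split/= -mulr_sumr cross square; lra.
Qed.

End Orthonormal.

Section Spectral.
Variables (R : realType) (V : hilbertType R).

(** By symmetry the matrix of [c] in [e] is Hermitian, and the unitary matrix that diagonalises it
    carries [e] to an eigenbasis of the same span. *)
Lemma spectral_fam n (e : 'I_n -> V) (c : V -> V) :
  linear c -> orthonormal_fam e -> (forall x, proj_fam e (c x) = c x) ->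
  (forall x y, inner (c x) y = inner x (c y)) ->
  exists (h : 'I_n -> V) (g : 'I_n -> R), [/\ orthonormal_fam h,
    forall x, proj_fam h x = proj_fam e x & forall k, c (h k) = (g k)%:C *: h k].
Proof.
move=> cl eo ec csym.
(* Row [i] holds the coordinates of [c (e i)]. The matrix thus acts on rows from the right, and the
   rows of [P] below are the eigenvectors. *)
pose C : 'M[R[i]]_n := \matrix_(i, j) inner (c (e i)) (e j).
have Cherm : C \is hermsymmx.
  apply/is_hermitianmxP; rewrite expr0 scale1r; apply/matrixP => i j.
  by rewrite !mxE csym innerC.
have Cspec := (orthomx_spectralP (hermitian_normalmx Cherm)).
have Dreal := hermitian_spectral_diag_real Cherm.
set P := spectralmx C in Cspec; set D := spectral_diag C in Cspec Dreal.
have PU : P \is unitarymx by exact: spectral_unitarymx.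
pose g k := complex.Re (D 0 k).
have gE k : D 0 k = (g k)%:C by rewrite /g RRe_real//; move/mxOverP: Dreal; exact.
have PP i j : \sum_k P i k * Num.conj (P j k) = (i == j)%:R.
  have /unitarymxP/matrixP/(_ i j) := PU; rewrite !mxE => <-.
  by apply: eq_bigr => k _; rewrite !mxE.
have PP' i j : \sum_k Num.conj (P k i) * P k j = (i == j)%:R.
  have : (P^t* *m P)%sesqui = 1%:M.
    by rewrite -invmx_unitary// mulVmx// unitarymx_unit.
  move/matrixP/(_ i j); rewrite !mxE => <-.
  by apply: eq_bigr => k _; rewrite !mxE.
have PC k j : \sum_i P k i * C i j = D 0 k * P k j.
  have : P *m C = diag_mx D *m P.
    by rewrite {1}Cspec !mulmxA mulmxV ?mul1mx// unitarymx_unit.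
  move/matrixP/(_ k j); rewrite !mxE => ->.
  rewrite (bigD1 k)//= !mxE eqxx mulr1n big1 ?addr0// => i ik.
  by rewrite !mxE eq_sym (negPf ik) mulr0n mul0r.
pose h k := \sum_j P k j *: e j.
have he x k : inner x (h k) = \sum_j Num.conj (P k j) * inner x (e j).
  by rewrite inner_sumr; apply: eq_bigr => j _; rewrite innerZr.
have eh j : e j = \sum_k Num.conj (P k j) *: h k.
  rewrite /h; under eq_bigr do rewrite scaler_sumr.
  rewrite exchange_big/=; under eq_bigr do under eq_bigr do rewrite scalerA.
  under eq_bigr do rewrite -scaler_suml PP'.
  rewrite (bigD1 j)//= eqxx scale1r big1 ?addr0// => i ij.
  by rewrite eq_sym (negPf ij) scale0r.
exists h, g; split.
- move=> k l; rewrite he; under eq_bigr do rewrite inner_suml.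
  rewrite -PP; apply: eq_bigr => j _.
  under eq_bigr do rewrite innerZl eo.
  by rewrite sum_delta mulrC.
- move=> x; rewrite /proj_fam; under [RHS]eq_bigr do rewrite [X in _ *: X]eh scaler_sumr.
  rewrite exchange_big/=; apply: eq_bigr => k _; rewrite he scaler_suml.
  by apply: eq_bigr => j _; rewrite scalerA mulrC.
- move=> k; rewrite -gE {1}/h lin_comb//.
  under eq_bigr do rewrite -[c _]ec /proj_fam scaler_sumr.
  rewrite exchange_big/= /h scaler_sumr; apply: eq_bigr => j _.
  rewrite scalerA -PC scaler_suml; apply: eq_bigr => i _.
  by rewrite scalerA mxE.
Qed.

Lemma spectral_famE n (h : 'I_n -> V) (g : 'I_n -> R) (c : V -> V) :
  orthonormal_fam h -> (forall x, proj_fam h (c x) = c x) ->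
  (forall x y, inner (c x) y = inner x (c y)) ->
  (forall k, c (h k) = (g k)%:C *: h k) ->
  forall x, c x = \sum_k ((g k)%:C * inner x (h k)) *: h k.
Proof.
move=> ho hc csym ch x; rewrite -hc; apply: eq_bigr => k _; congr (_ *: _).
by rewrite csym ch innerZr; congr (_ * _); exact: conjc_real.
Qed.

End Spectral.

(** * The Hilbert space of Hilbert-Schmidt operators *)

Section CauchySchwarz.
Variables (C : numClosedFieldType) (U : lmodType C) (f : {dot U for @Num.conj C}).

(** Pythagoras, after removing from [u] its component along [v]. It is proved for a bare form
    because the triangle inequality has to precede the norm of [hilbert_of]. *)
Lemma dot_CauchySchwarz u v : `|f u v| ^+ 2 <= f u u * f v v.
Proof.
have [->|v0] := eqVneq v 0.
  have f0 x : f x 0 = 0 by exact: linear0r.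
  by rewrite !f0 normr0 expr0n mulr0.
have vv : f v v != 0 by rewrite dnorm_eq0.
pose a := f u v / f v v; pose w := u - a *: v.
have wv : f w v = 0 by rewrite linearBl/= linearZl_LR/= divfK ?subrr.
have -> : f u u = f w w + `|a| ^+ 2 * f v v.
  rewrite -dnormZ -[in LHS](subrK (a *: v) u) -/w hnormDd//.
  by rewrite linearZr_LR/= wv mulr0.
rewrite mulrDl -mulrA normrM exprMn normfV (ger0_norm (dnorm_ge0 _ _)).
rewrite -expr2 exprVn divfK ?expf_neq0// lerDr.
by rewrite mulr_ge0 ?dnorm_ge0.
Qed.

Lemma dot_triangle u v : sqrtC (f (u + v) (u + v)) <= sqrtC (f u u) + sqrtC (f v v).
Proof.
rewrite -(@ler_pXn2r _ 2)// ?nnegrE ?addr_ge0 ?sqrtC_ge0 ?dnorm_ge0//.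
rewrite sqrrD !sqrtCK dnormD addrAC lerD2r lerD2l.
have -> : f u v + (f u v)^* = 'Re (f u v) *+ 2.
  by rewrite ReE -mulr_natr divfK// pnatr_eq0.
rewrite lerMn2r/=; apply: (le_trans (leif_Re_Creal _)).
rewrite -(@ler_pXn2r _ 2)// ?nnegrE ?mulr_ge0 ?sqrtC_ge0 ?dnorm_ge0//.
by rewrite exprMn !sqrtCK dot_CauchySchwarz.
Qed.

End CauchySchwarz.

(** Input for building a Hilbert space on the submodule [hd_dom]. The form is controlled there only,
    and completeness is phrased with filters on the ambient module, since no topology is available
    yet. It serves both for Hilbert-Schmidt operators and for closed subspaces. *)
Record hilbert_data (R : realType) := HilbertData {
  hd_mod : lmodType R[i];
  hd_dom : {pred hd_mod};
  hd_submod : submod_closed hd_dom;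
  hd_form : hd_mod -> hd_mod -> R[i];
  hd_linear : forall a, {in hd_dom & &, forall x y z,
    hd_form (a *: x + y) z = a * hd_form x z + hd_form y z};
  hd_herm : {in hd_dom &, forall x y, hd_form x y = Num.conj (hd_form y x)};
  hd_pos : {in hd_dom, forall x, x != 0 -> 0 < hd_form x x};
  hd_complete : forall F : set_system hd_mod, ProperFilter F ->
    (forall e : R, 0 < e -> exists A, [/\ F A, forall x, A x -> x \in hd_dom &
      forall x y, A x -> A y -> hd_form (x - y) (x - y) <= e%:C]) ->
    exists2 x, x \in hd_dom & forall e : R, 0 < e ->
      F [set y | hd_form (x - y) (x - y) <= e%:C]
}.

Section HilbertOfData.
Variables (R : realType) (d : hilbert_data R).

HB.instance Definition _ := GRing.isSubmodClosed.Build R[i] (hd_mod d) (@hd_dom R d)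
  (hd_submod d).

Definition hilbert_of := {x : hd_mod d | x \in @hd_dom R d}.
HB.instance Definition _ := SubChoice.on hilbert_of.
HB.instance Definition _ := [SubChoice_isSubLmodule of hilbert_of by <:].

Implicit Types x y z : hilbert_of.

Definition hd_inner x y : R[i] := hd_form (\val x) (\val y).

Let hd_innerP a x y z : hd_inner (a *: x + y) z = a * hd_inner x z + hd_inner y z.
Proof. exact: (hd_linear a (valP x) (valP y) (valP z)). Qed.

Let hd_innerC x y : hd_inner x y = (-1) ^+ false * Num.conj (hd_inner y x).
Proof. by rewrite expr0 mul1r; exact: (hd_herm (valP x) (valP y)). Qed.

Let hd_inner_bilinear : bilinear_for ( *%R : GRing.Scale.law R[i] R[i])
  ((Num.conj : {rmorphism R[i] -> R[i]}) \; *%R : GRing.Scale.law R[i] R[i]) hd_inner.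
Proof.
split=> [z a x y|z a x y] /=; first exact: hd_innerP.
have C u v : hd_inner u v = Num.conj (hd_inner v u) by rewrite hd_innerC expr0 mul1r.
by rewrite C hd_innerP rmorphD rmorphM/= -!C.
Qed.

HB.instance Definition _ := bilinear_isBilinear.Build R[i] hilbert_of hilbert_of R[i]
  _ _ hd_inner hd_inner_bilinear.
HB.instance Definition _ := isHermitianSesquilinear.Build R[i] hilbert_of false
  Num.conj hd_inner hd_innerC.

Let hd_inner_gt0 x : x != 0 -> 0 < hd_inner x x.
Proof. by move=> x0; apply: hd_pos; [exact: valP|exact: x0]. Qed.

HB.instance Definition _ := isDotProduct.Build R[i] hilbert_of hd_inner hd_inner_gt0.

Definition hd_norm x : R[i] := sqrtC (hd_inner x x).

Let hd_normD x y : hd_norm (x + y) <= hd_norm x + hd_norm y.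
Proof. exact: dot_triangle. Qed.

Let hd_normZ a x : hd_norm (a *: x) = `|a| * hd_norm x.
Proof.
rewrite /hd_norm dnormZ sqrtCM ?nnegrE ?exprn_ge0//.
by rewrite sqrCK.
Qed.

Let hd_norm_eq0 x : hd_norm x = 0 -> x = 0.
Proof. by move/eqP; rewrite sqrt_dnorm_eq0 => /eqP. Qed.

HB.instance Definition _ := Lmodule_isNormed.Build R[i] hilbert_of
  hd_normD hd_normZ hd_norm_eq0.

Let hd_cauchy_cvg (F : set_system hilbert_of) : ProperFilter F -> cauchy F -> cvg F.
Proof.
move=> FF /cauchyP Fc.
have norm_form x : hd_form (\val x) (\val x) = `|x| ^+ 2 by rewrite sqrtCK.
have [e e0|x0 x0d x0F] := hd_complete (F := \val @ F).
  have e20 : 0 < (Num.sqrt e / 2)%:C :> R[i] by rewrite ltcR divr_gt0 ?sqrtr_gt0.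
  have [x Fx] := Fc _ e20; exists [set \val y | y in ball x (Num.sqrt e / 2)%:C]; split.
  - change (F (\val @^-1` [set \val y | y in ball x (Num.sqrt e / 2)%:C])).
    by apply: filterS Fx => y xy; exists y.
  - by move=> _ [y _ <-]; exact: valP.
  - move=> _ _ [y xy <-] [z xz <-].
    rewrite -[X in hd_form X]/(\val (y - z)) -[X in hd_form _ X]/(\val (y - z)) norm_form.
    have -> : e%:C = (Num.sqrt e)%:C ^+ 2 by rewrite -rmorphXn/= sqr_sqrtr// ltW.
    rewrite ler_pXn2r ?nnegrE ?ler0c ?sqrtr_ge0//.
    rewrite [Num.sqrt e]splitr rmorphD/= -(subrKA x) (le_trans (ler_normD _ _))//.
    move: xy xz; rewrite -!ball_normE/= => xy xz.
    by rewrite lerD// ?ltW// distrC.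
pose l : hilbert_of := Sub x0 x0d.
apply/cvg_ex; exists l; apply/cvgrPdist_le => e e0.
have eE : (complex.Re e)%:C = e by rewrite RRe_real// gtr0_real.
have e20 : 0 < complex.Re e ^+ 2 by rewrite exprn_gt0// -ltcR eE.
have := x0F _ e20; change (F (\val @^-1` [set y | hd_form (x0 - y) (x0 - y) <= (complex.Re e ^+ 2)%:C]) ->
  F [set y : hilbert_of | `|l - y| <= e]).
apply: filterS => y /=.
rewrite -[X in hd_form X]/(\val (l - y)) -[X in hd_form _ X]/(\val (l - y)).
have -> : (complex.Re e ^+ 2)%:C = e ^+ 2 by rewrite rmorphXn/= eE.
by rewrite norm_form ler_pXn2r ?nnegrE// ltW.
Qed.

HB.instance Definition _ := Uniform_isComplete.Build hilbert_of hd_cauchy_cvg.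
HB.instance Definition _ := CompleteNormedModule_isHilbert.Build R hilbert_of (fun x => sqrtCK _).

End HilbertOfData.

Section Continuity.
Variable R : realType.
Local Notation C := (R[i] : numClosedFieldType).

Lemma cvg_Re (T : Type) (F : set_system T) (f : T -> C) (l : C) : Filter F ->
  f @ F --> l -> (fun x => complex.Re (f x)) @ F --> complex.Re l.
Proof.
move=> FF /cvgrPdist_le fl; apply/cvgrPdist_le => e e0.
have e0' : 0 < e%:C :> R[i] by rewrite ltcR.
apply: filterS (fl _ e0') => x; apply: contraTT; rewrite -!real_ltNge ?num_real//; last first.
  by rewrite ?ger0_real// ?ler0c ltW.
move=> H; rewrite (@lt_le_trans _ _ `|complex.Re l - complex.Re (f x)|%:C)//.
  by rewrite ltcR.
by rewrite -ReN -ReD; exact: normc_ge_Re.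
Qed.

Lemma cvg_addC (T : Type) (F : set_system T) (f g : T -> C) (l m : C) : Filter F ->
  f @ F --> l -> g @ F --> m -> (fun x => f x + g x) @ F --> l + m.
Proof. by move=> FF fl gm; exact: (cvgD fl gm). Qed.

Lemma cvg_subC (T : Type) (F : set_system T) (f g : T -> C) (l m : C) : Filter F ->
  f @ F --> l -> g @ F --> m -> (fun x => f x - g x) @ F --> l - m.
Proof. by move=> FF fl gm; exact: (cvgB fl gm). Qed.

Lemma cvg_mulC (T : Type) (F : set_system T) (g : T -> C) (a l : C) : Filter F ->
  g @ F --> l -> (fun x => a * g x) @ F --> a * l.
Proof. by move=> FF gl; exact: (cvgM (cvg_cst a) gl). Qed.

Lemma cvg_nsq (V : hilbertType R) (T : Type) (F : set_system T) (f : T -> V) (l : V) :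
  Filter F -> f @ F --> l -> (fun x => nsq (f x)) @ F --> nsq l.
Proof.
move=> FF fl.
have nE (x : V) : nsq x = complex.Re (`|x| * `|x|).
  by rewrite -expr2 norm_nsq.
under eq_fun do rewrite nE; rewrite nE; apply: cvg_Re.
by apply: cvgM; apply: cvg_norm.
Qed.

End Continuity.

(** * Hilbert-Schmidt norms through finite orthonormal families *)

Section HilbertSchmidt.
Variables (R : realType) (V : hilbertType R).
Local Notation C := (R[i] : numClosedFieldType).
Implicit Types (S T : V -> V) (x y : V).

Record onfam := OnFam {
  onfam_size : nat;
  onfam_vec :> 'I_onfam_size -> V;
  onfamP : orthonormal_fam onfam_vec
}.
Implicit Types f k : onfam.

(** Inclusion of the spans. It directs the finite orthonormal families, which stand in for an
    orthonormal basis. *)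
Definition onfam_le f k := forall i, proj_fam k (f i) = f i.

Lemma onfam_span (s : seq V) : exists k : onfam, forall x, x \in s -> proj_fam k x = x.
Proof. by have [n [h [ho hs]]] := gram_schmidt s; exists (OnFam ho). Qed.

Lemma onfam_le_trans k f l : onfam_le f k -> onfam_le k l -> onfam_le f l.
Proof.
move=> fk kl i.
rewrite -(fk i) [X in proj_fam l X]/proj_fam (lin_comb (proj_fam_linear _)).
by apply: eq_bigr => j _; rewrite kl.
Qed.

Lemma onfam_directed f k : exists l, onfam_le f l /\ onfam_le k l.
Proof.
have [l lP] := onfam_span (codom f ++ codom k).
by exists l; split=> i; apply: lP; rewrite mem_cat codom_f ?orbT.
Qed.

Lemma onfam1 x : nsq x = 1 -> exists f, forall (F : V -> R), \sum_i F (f i) = F x.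
Proof.
move=> x1; have ho : orthonormal_fam (fun i : 'I_1 => x).
  by move=> i j; rewrite nsqE x1 !ord1.
by exists (OnFam ho) => F; rewrite big_ord1.
Qed.

Definition energy f T := \sum_i nsq (T (f i)).

Lemma energy_ge0 f T : 0 <= energy f T.
Proof. by apply: sumr_ge0 => i _; exact: nsq_ge0. Qed.

Lemma energy_mono f k T : linear T -> onfam_le f k -> energy f T <= energy k T.
Proof. by move=> Tl fk; apply: energy_le => //; exact: onfamP. Qed.

Lemma nsqD_le x y : nsq (x + y) <= 2 * nsq x + 2 * nsq y.
Proof. by rewrite -parallelogram lerDl nsq_ge0. Qed.

Lemma energyD f S T : energy f (fun x => S x + T x) <= 2 * energy f S + 2 * energy f T.
Proof.
rewrite /energy !mulr_sumr -big_split; apply: ler_sum => i _; exact: nsqD_le.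
Qed.

Lemma energyZ f a T : energy f (fun x => a *: T x) = csq a * energy f T.
Proof. by rewrite /energy mulr_sumr; apply: eq_bigr => i _; rewrite nsqZ. Qed.

(* The squared Hilbert-Schmidt norm; the supremum over finite orthonormal families
   replaces the sum over an orthonormal basis of [V]. *)
Definition hs_sq T := sup [set energy f T | f in [set: onfam]].

Section Restricted.
Variable Z : set V.

(** A bound on the energies is demanded explicitly, because [hs_sq] is a supremum in [R] and says
    nothing when the energies are unbounded. *)
Definition hs_pred : {pred V -> V} := fun T =>
  `[< [/\ linear T, exists M, forall f, energy f T <= M & forall z, Z z -> T z = 0] >].

Lemma hs_linear T : T \in hs_pred -> linear T.
Proof. by move=> /asboolP[]. Qed.

Lemma hs_submod : submod_closed hs_pred.
Proof.
split.
  apply/asboolP; split=> [a x y /=||]; first by rewrite scaler0 addr0.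
  - by exists 0 => f; rewrite /energy big1// => i _; exact: nsq0.
  - by [].
move=> a S T /asboolP[Sl [M SM] SZ] /asboolP[Tl [N TN] TZ]; apply/asboolP; split.
- move=> b x y; change (a *: S (b *: x + y) + T (b *: x + y) =
    b *: (a *: S x + T x) + (a *: S y + T y)).
  rewrite Sl Tl.
  by rewrite !scalerDr !scalerA (mulrC a) addrACA.
- exists (2 * (csq a * M) + 2 * N) => f.
  apply: (le_trans (energyD f (fun x => a *: S x) T)).
  by rewrite energyZ lerD// ler_pM2l// ler_wpM2l// csq_ge0.
- by move=> z Zz; change (a *: S z + T z = 0); rewrite SZ// TZ// scaler0 addr0.
Qed.

Lemma energy_le_hs f T : T \in hs_pred -> energy f T <= hs_sq T.
Proof.
move=> /asboolP[_ [M TM] _]; apply: ub_le_sup; last by exists f.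
by exists M => _ [k _ <-].
Qed.

Lemma hs_sq_le T M : (forall f, energy f T <= M) -> hs_sq T <= M.
Proof.
move=> TM; apply: ge_sup => [|_ [f _ <-]//].
have [f _] := onfam_span [::].
by exists (energy f T), f.
Qed.

Lemma hs_sq_ge0 T : T \in hs_pred -> 0 <= hs_sq T.
Proof.
have [f _] := onfam_span [::].
by move=> /(energy_le_hs f); apply: le_trans; exact: energy_ge0.
Qed.

(** A unit vector is an orthonormal family of size one. Hilbert-Schmidt estimates thereby become
    pointwise ones. *)
Lemma nsq_hs T x : T \in hs_pred -> nsq (T x) <= hs_sq T * nsq x.
Proof.
move=> Th; have [->|x0] := eqVneq x 0.
  by rewrite (lin_0 (hs_linear Th)) nsq0 mulr0.
have [a a1 xE] := normalize x0.
rewrite xE (lin_Z (hs_linear Th)) !nsqZ mulrCA ler_wpM2l ?csq_ge0//.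
rewrite -nsqZ a1 mulr1.
by have [f fE] := onfam1 a1; rewrite -(fE (fun y => nsq (T y))) energy_le_hs.
Qed.

Definition onfam_filter : set_system onfam :=
  [set A | exists f, forall k, onfam_le f k -> A k].

Lemma onfam_filter_proper : ProperFilter onfam_filter.
Proof.
apply: Build_ProperFilter.
  by move=> [f /(_ f)]; apply=> i; exact/proj_fam_h/onfamP.
split.
- by have [f _] := onfam_span [::]; exists f.
- move=> A B [f fA] [k kB]; have [l [fl kl]] := onfam_directed f k.
  exists l => m lm; split; [apply: fA|apply: kB].
    exact: onfam_le_trans fl lm.
  exact: onfam_le_trans kl lm.
- by move=> A B AB [f fA]; exists f => k /fA/AB.
Qed.

(** By [energy_mono] the supremum is a limit along growing spans. Limits, unlike suprema, pass
    through the polarization identity; this is how [hs_form] is shown to be sesquilinear. *)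
Lemma cvg_energy T : T \in hs_pred ->
  (fun f => (energy f T)%:C : C) @ onfam_filter --> ((hs_sq T)%:C : C).
Proof.
move=> Th; have FF := onfam_filter_proper; apply/cvgrPdist_le => e e0.
have eE : (complex.Re e)%:C = e by rewrite RRe_real// gtr0_real.
have : hs_sq T - complex.Re e < hs_sq T by rewrite ltrBlDr ltrDl -ltcR eE.
move=> /(sup_gt _); case.
  by have [f _] := onfam_span [::]; exists (energy f T), f.
move=> _ [f _ <-] eT; exists f => k fk /=.
rewrite -rmorphB/= -[e]eE normc_def/= expr0n addr0 sqrtr_sqr lecR.
rewrite ger0_norm ?subr_ge0 ?energy_le_hs// lerBlDr -lerBlDl.
by rewrite (le_trans (ltW eT))// energy_mono//; exact: hs_linear.
Qed.

Definition energy_form f S T := \sum_i inner (S (f i)) (T (f i)).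

Lemma energy_formxx f T : energy_form f T T = (energy f T)%:C.
Proof. by rewrite real_sum; apply: eq_bigr => i _; rewrite nsqE. Qed.

Lemma inner_polarization x y : inner x y = 4^-1 * ((nsq (x + y))%:C - (nsq (x - y))%:C
  + 'i * (nsq (x + 'i *: y))%:C - 'i * (nsq (x - 'i *: y))%:C).
Proof.
have i2 : 'i * 'i = -1 :> R[i] by rewrite -expr2 sqrCi.
have ic : Num.conj ('i : R[i]) = - 'i by rewrite conjCi.
rewrite -!nsqE !innerBl !innerDl !innerBr !innerDr !innerZl !innerZr ic.
set a := inner x x; set b := inner x y; set c := inner y x; set e := inner y y.
rewrite [X in 4^-1 * X](_ : _ = 2 * b + 2 * c - 2 * ('i * 'i) * b + 2 * ('i * 'i) * c).
  by rewrite i2; field.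
by ring.
Qed.

(* Polarization: the limit of [\sum_i <S f_i, T f_i>] along the directed set of
   finite orthonormal families [f]. *)
Definition hs_form S T : R[i] := 4^-1 * ((hs_sq (S + T))%:C - (hs_sq (S - T))%:C
  + 'i * (hs_sq (S + 'i *: T))%:C - 'i * (hs_sq (S - 'i *: T))%:C).

HB.instance Definition _ := GRing.isSubmodClosed.Build R[i] (V -> V) hs_pred hs_submod.

Lemma cvg_hs_form S T : S \in hs_pred -> T \in hs_pred ->
  (fun f => energy_form f S T : C) @ onfam_filter --> (hs_form S T : C).
Proof.
move=> Sh Th; have FF := onfam_filter_proper.
have -> : (fun f => energy_form f S T) = (fun f => 4^-1 *
   ((energy f (S + T))%:C - (energy f (S - T))%:C
  + 'i * (energy f (S + 'i *: T))%:C - 'i * (energy f (S - 'i *: T))%:C)).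
  apply/funext => f; rewrite !real_sum !mulr_sumr -!sumrB -big_split/= -sumrB mulr_sumr.
  by apply: eq_bigr => i _; rewrite inner_polarization.
apply: cvg_mulC; apply: cvg_subC; last first.
  by apply: cvg_mulC; apply: cvg_energy; rewrite rpredB ?rpredZ.
apply: cvg_addC; last by apply: cvg_mulC; apply: cvg_energy; rewrite rpredD ?rpredZ.
by apply: cvg_subC; apply: cvg_energy; rewrite ?rpredB ?rpredD.
Qed.

End Restricted.
End HilbertSchmidt.

Section HilbertSchmidtSpace.
Variables (R : realType) (V : hilbertType R) (Z : set V).
Local Notation C := (R[i] : numClosedFieldType).
Local Notation HS := (hs_pred Z).
Implicit Types (S T : V -> V) (x y : V) (f : onfam V).

Let FF := onfam_filter_proper V.
#[local] Existing Instance FF.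

Lemma cvg_uniqueC (T : Type) (F : set_system T) (g : T -> C) (l m : C) :
  ProperFilter F -> g @ F --> l -> g @ F --> m -> l = m.
Proof. by move=> PF gl gm; apply: (cvg_unique (@norm_hausdorff C C^o) gl gm). Qed.

Lemma hs_formxx T : T \in HS -> hs_form T T = (hs_sq T)%:C.
Proof.
move=> Th; apply: (cvg_uniqueC FF (cvg_hs_form Th Th)).
by under eq_fun do rewrite energy_formxx; exact: cvg_energy Th.
Qed.

Lemma hs_form_linear a : {in HS & &, forall S T S',
  hs_form (a *: S + T) S' = a * hs_form S S' + hs_form T S'}.
Proof.
move=> S T S' Sh Th Sh'.
have aSTh : a *: S + T \in HS by rewrite rpredD ?rpredZ.
apply: (cvg_uniqueC FF (cvg_hs_form aSTh Sh')).
have -> : (fun f => energy_form f (a *: S + T) S') =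
    (fun f => a * energy_form f S S' + energy_form f T S').
  apply/funext => f; rewrite mulr_sumr -big_split; apply: eq_bigr => i _ /=.
  by rewrite -innerZl -innerDl.
apply: cvg_addC; last exact: (cvg_hs_form Th Sh').
by apply: cvg_mulC; exact: (cvg_hs_form Sh Sh').
Qed.

Lemma cvg_conjC (T : Type) (F : set_system T) (g : T -> C) (l : C) : Filter F ->
  g @ F --> l -> (fun t => Num.conj (g t) : C) @ F --> (Num.conj l : C).
Proof.
move=> PF /cvgrPdist_le gl; apply/cvgrPdist_le => e e0.
by apply: filterS (gl e e0) => t; rewrite -rmorphB norm_conjC.
Qed.

Lemma hs_form_herm : {in HS &, forall S T, hs_form S T = Num.conj (hs_form T S)}.
Proof.
move=> S T Sh Th; apply: (cvg_uniqueC FF (cvg_hs_form Sh Th)).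
have -> : (fun f => energy_form f S T) = (fun f => Num.conj (energy_form f T S)).
  by apply/funext => f; rewrite rmorph_sum; apply: eq_bigr => i _; exact: innerC.
exact: cvg_conjC (cvg_hs_form Th Sh).
Qed.

Lemma hs_form_pos : {in HS, forall T, T != 0 -> 0 < hs_form T T}.
Proof.
move=> T Th T0; rewrite hs_formxx// ltcR lt_def (hs_sq_ge0 Th) andbT.
apply: contra_neq T0 => T0; apply/funext => x; apply/eqP; rewrite -nsq_eq0.
have := nsq_hs x Th; rewrite T0 mul0r => Tx.
by rewrite eq_le Tx nsq_ge0.
Qed.

Lemma cvg_energy_pointwise (F : set_system (V -> V)) f T L : Filter F ->
  (forall x, (fun S => S x) @ F --> L x) ->
  (fun S => energy f (fun x => S x - T x)) @ F --> energy f (fun x => L x - T x).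
Proof.
move=> PF FL; rewrite /energy.
have H (r : seq 'I_(onfam_size f)) : (fun S => \sum_(i <- r) nsq (S (f i) - T (f i))) @ F -->
    \sum_(i <- r) nsq (L (f i) - T (f i)).
  elim: r => [|i r IH].
    under eq_fun do rewrite big_nil; rewrite big_nil; exact: cvg_cst.
  under eq_fun do rewrite big_cons; rewrite big_cons; apply: cvgD => //.
  by apply: cvg_nsq; apply: cvgB; [exact: FL|exact: cvg_cst].
exact: H.
Qed.

(** As for square-summable sequences: the limit is taken pointwise. Each energy involves finitely
    many vectors and is continuous for pointwise convergence, so the Cauchy bounds pass to the limit
    uniformly in the family. *)
Lemma hs_form_complete (F : set_system (V -> V)) : ProperFilter F ->
    (forall e : R, 0 < e -> exists A, [/\ F A, forall T, A T -> T \in HS &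
      forall S T, A S -> A T -> hs_form (S - T) (S - T) <= e%:C]) ->
    exists2 T, T \in HS & forall e : R, 0 < e ->
      F [set S | hs_form (T - S) (T - S) <= e%:C].
Proof.
move=> PF Fc.
have FH : \forall T \near F, T \in HS.
  by have [A [FA AH _]] := Fc 1 ltr01; apply: filterS FA.
have Fsq e : 0 < e -> exists2 A, F A & forall S T, A S -> A T ->
    [/\ S \in HS, T \in HS & hs_sq (S - T) <= e].
  move=> /Fc[A [FA AH Ae]]; exists A => // S T AS AT.
  have [Sh Th] := (AH _ AS, AH _ AT); split=> //.
  by rewrite -lecR -(@hs_formxx (S - T)) ?Ae// rpredB.
have Fx x : cvg ((fun T => T x) @ F).
  apply: cauchy_cvg; apply/cauchyP => e e0.
  have eE : (complex.Re e)%:C = e by rewrite RRe_real// gtr0_real.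
  have e0' : 0 < complex.Re e by rewrite -ltcR eE.
  (* Multiplied by [nsq x] this stays below the squared radius; the added 1 avoids a division by
     zero and the final half gives a strict inequality. *)
  have d0 : 0 < (complex.Re e) ^+ 2 / (nsq x + 1) / 2.
    by rewrite !divr_gt0 ?exprn_gt0// ltr_wpDl// nsq_ge0.
  have [A FA Ad] := Fsq _ d0; have [T AT] := filter_ex FA.
  exists (T x); change (F [set S | ball (T x) e (S x)]); apply: filterS FA => S AS.
  rewrite -ball_normE/= -eE norm_lt_nsq; last exact: ltW.
  have [Th Sh STd] := Ad _ _ AT AS.
  have := nsq_hs x (rpredB Th Sh : T - S \in HS).
  rewrite [(T - S) x]/(T x - S x) => /le_lt_trans; apply.
  rewrite (@le_lt_trans _ _ ((complex.Re e) ^+ 2 / (nsq x + 1) / 2 * (nsq x + 1)))//.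
    have nx := nsq_ge0 x.
    by rewrite ler_pM ?(hs_sq_ge0 (rpredB Th Sh : T - S \in HS))// lerDl.
  rewrite mulrAC divfK; first by rewrite ltr_pdivrMr// ltr_pMr ?exprn_gt0// ltr1n.
  by rewrite gt_eqF// ltr_wpDl// nsq_ge0.
pose L x := lim ((fun T => T x) @ F).
have FL x : (fun T => T x) @ F --> L x by exact: Fx.
have LB e A f : 0 < e -> F A -> (forall S T, A S -> A T ->
    [/\ S \in HS, T \in HS & hs_sq (S - T) <= e]) ->
    forall T, A T -> energy f (fun x => L x - T x) <= e.
  move=> e0 FA Ae T AT.
  apply: (@closed_cvg _ _ F PF (fun S => energy f (fun x => S x - T x)) [set y | y <= e]).
  - exact: closed_le.
  - apply: filterS FA => S AS /=; have [Sh Th STe] := Ae _ _ AS AT.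
    by rewrite (le_trans _ STe)// (energy_le_hs _ (rpredB Sh Th : S - T \in HS)).
  - exact: cvg_energy_pointwise.
have Ll : linear L.
  move=> a x y.
  have : (fun T => a *: T x + T y) @ F --> a *: L x + L y.
    by apply: cvgD; [apply: cvgZr|]; exact: FL.
  apply: (cvg_unique (@norm_hausdorff C V)).
  apply: cvg_trans (FL (a *: x + y)); apply: near_eq_cvg.
  by apply: filterS FH => T /hs_linear ->.
have LH : L \in HS.
  apply/asboolP; split=> //.
    have [A FA A1] := Fsq 1 ltr01; have [T AT] := filter_ex FA.
    have [Th _ _] := A1 _ _ AT AT.
    exists (2 * 1 + 2 * hs_sq T) => f.
    have -> : L = (fun x => (L x - T x) + T x) by apply/funext => x; rewrite subrK.
    rewrite (le_trans (energyD f _ T))// lerD// ler_pM2l//; last exact: energy_le_hs Th.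
    exact: LB FA A1 _ AT.
  move=> z Zz; apply: (cvg_unique (@norm_hausdorff C V) (FL z)).
  have c0 : (fun _ : V -> V => 0 : V) @ F --> (0 : V) by exact: cvg_cst.
  apply: cvg_trans c0; apply: near_eq_cvg.
  by apply: filterS FH => T /asboolP[_ _ ->].
exists L => // e e0; have [A FA Ae] := Fsq _ e0.
apply: filterS (FA) => T AT; have [Th _ _] := Ae _ _ AT AT.
rewrite /= hs_formxx ?rpredB// lecR; apply: hs_sq_le => f.
exact: (LB e A f e0 FA Ae T AT).
Qed.

Definition hs_data := HilbertData (hs_submod Z) hs_form_linear hs_form_herm
  hs_form_pos hs_form_complete.

End HilbertSchmidtSpace.

(** * The conjugation representation *)

Section EnergyRight.
Variables (R : realType) (V : hilbertType R).

Lemma nsq_parseval (v : onfam V) x : proj_fam v x = x -> nsq x = \sum_m csq (inner x (v m)).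
Proof. by move=> vx; rewrite -(nsq_sum_fam (@onfamP _ _ v)) -/(proj_fam v x) vx. Qed.

(* [<T D f_i, v_m> = <f_i, D' y_m>] where [y_m] depends on [T] only, so Bessel's
   inequality for [f] bounds the energy of [T D]. *)
Lemma energy_comp_right (T D D' : V -> V) (M : R) (f : onfam V) : linear T ->
  (forall x y, inner (D x) y = inner x (D' y)) ->
  (forall y, nsq (D' y) <= M * nsq y) ->
  exists k : onfam V, energy f (fun x => T (D x)) <= M * energy k T.
Proof.
move=> Tl DD' D'M; have [k kD] := onfam_span [seq D (f i) | i : 'I_(onfam_size f)].
have [v vT] := onfam_span [seq T (k l) | l : 'I_(onfam_size k)].
have kf i : proj_fam k (D (f i)) = D (f i) by apply: kD; exact: map_f (mem_enum _ _).
have vk l : proj_fam v (T (k l)) = T (k l) by apply: vT; exact: map_f (mem_enum _ _).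
have TDE i : T (D (f i)) = \sum_l inner (D (f i)) (k l) *: T (k l).
  by rewrite -{1}(kf i) lin_comb.
have vTD i : proj_fam v (T (D (f i))) = T (D (f i)).
  by rewrite TDE (lin_comb (proj_fam_linear _)); apply: eq_bigr => l _; rewrite vk.
pose y m := \sum_l Num.conj (inner (T (k l)) (v m)) *: k l.
have TDv i m : inner (T (D (f i))) (v m) = inner (f i) (D' (y m)).
  rewrite TDE inner_suml -DD' inner_sumr; apply: eq_bigr => l _.
  by rewrite innerZl innerZr conjCK mulrC.
exists k; rewrite /energy; under eq_bigr do rewrite (nsq_parseval (vTD _)).
rewrite exchange_big/=.
under [X in _ * X]eq_bigr do rewrite (nsq_parseval (vk _)).
rewrite [X in _ * X]exchange_big/= mulr_sumr; apply: ler_sum => m _.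
under eq_bigr do rewrite TDv innerC csq_conj.
rewrite (le_trans (bessel (@onfamP _ _ f) _))// (le_trans (D'M _))//.
rewrite /y (nsq_sum_fam (@onfamP _ _ k)).
by under [X in M * X <= _]eq_bigr do rewrite csq_conj.
Qed.

Lemma unitary_dist_ge0 (u v : unitary V) : 0 <= unitary_dist u v.
Proof.
have := unitary_dist_ub u v (x := 0); rewrite normr0 ler01 => /(_ isT); apply: le_trans.
by rewrite -ler0c RRe_real ?normr_real.
Qed.

Lemma nsq_unitary_dist (u v : unitary V) x :
  nsq (u x - v x) <= unitary_dist u v ^+ 2 * nsq x.
Proof.
have [->|x0] := eqVneq x 0; first by rewrite !(lin_0 (unitary_linear _)) subrr nsq0 mulr0.
have [a a1 xE] := normalize x0.
rewrite xE; move: (a *: x) a1 => w a1.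
rewrite !(lin_Z (unitary_linear _)) -scalerBr !(nsqZ a^-1) mulrCA ler_wpM2l ?csq_ge0//.
rewrite a1 mulr1.
have e1 : `|w| <= 1 by rewrite (norm1_nsq _).2.
have := unitary_dist_ub u v e1; set y := _ - _ => yd.
have nyE : nsq y = complex.Re `|y| ^+ 2.
  by apply: complexI; rewrite -norm_nsq rmorphXn/= RRe_real// normr_real.
have y0 : 0 <= complex.Re `|y| by rewrite -ler0c RRe_real ?normr_real.
by rewrite nyE ler_pXn2r// nnegrE// (le_trans y0).
Qed.

Lemma nsq_unitary (u : unitary V) x : nsq (u x) = nsq x.
Proof. by rewrite /nsq unitary_inner. Qed.

End EnergyRight.

Section ConjugationRep.
Variables (R : realType) (V : hilbertType R) (G : topGroupType)
  (rho : {multiplicative G -> unitary V}) (Z : set V).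
Hypothesis ZG : forall g z, Z z -> Z (rho g z).

Local Notation HS := (hilbert_of (hs_data Z)).

Lemma rhoM g h x : rho (g * h)%g x = rho g (rho h x).
Proof. by rewrite gmulfM. Qed.

Lemma rho1 x : rho 1%g x = x.
Proof. by apply: (unitary_inj (u := rho 1%g)); rewrite -rhoM mulg1. Qed.

Lemma rhoK g x : rho g^-1%g (rho g x) = x.
Proof. by rewrite -rhoM mulVg rho1. Qed.

Lemma rhoVK g x : rho g (rho g^-1%g x) = x.
Proof. by rewrite -rhoM mulgV rho1. Qed.

Lemma rho_adjoint g x y : inner (rho g x) y = inner x (rho g^-1%g y).
Proof. by rewrite -[in RHS](unitary_inner (rho g)) rhoVK. Qed.

Definition conj_op g (T : V -> V) : V -> V := fun x => rho g (T (rho g^-1%g x)).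

Lemma onfam_rho_subproof g (f : onfam V) : orthonormal_fam (fun i => rho g (f i)).
Proof. by move=> i j; rewrite unitary_inner onfamP. Qed.

Definition onfam_rho g (f : onfam V) : onfam V := OnFam (@onfam_rho_subproof g f).

Lemma energy_conj_op g f T : energy f (conj_op g T) = energy (onfam_rho g^-1%g f) T.
Proof. by apply: eq_bigr => i _; rewrite nsq_unitary. Qed.

Lemma conj_opP a g S T : conj_op g (a *: S + T) = a *: conj_op g S + conj_op g T.
Proof. by apply/funext => x; exact: unitary_linear. Qed.

(** [rho g] permutes the finite orthonormal families, so both suprema run over the same energies. *)
Lemma hs_sq_conj_op g T : hs_sq (conj_op g T) = hs_sq T.
Proof.
congr sup; apply/seteqP; split=> _ [f _ <-].
  by exists (onfam_rho g^-1%g f); rewrite ?energy_conj_op.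
exists (onfam_rho g f) => //; rewrite energy_conj_op.
by apply: eq_bigr => i _ /=; rewrite rhoK.
Qed.

Lemma conj_op_hs g T : T \in hs_pred Z -> conj_op g T \in hs_pred Z.
Proof.
move=> Th; apply/asboolP; split.
- move=> a x y; rewrite /conj_op (unitary_linear (rho g^-1%g)) (hs_linear Th).
  exact: unitary_linear.
- exists (hs_sq T) => f; rewrite energy_conj_op; exact: energy_le_hs Th.
- move=> z Zz; rewrite /conj_op; move/asboolP: Th => [_ _ ->]; last exact: ZG.
  exact: lin_0 (unitary_linear _).
Qed.

Lemma hs_form_conj_op g S T : hs_form (conj_op g S) (conj_op g T) = hs_form S T.
Proof.
have cD S' T' : conj_op g S' + conj_op g T' = conj_op g (S' + T').
  by have := conj_opP 1 g S' T'; rewrite !scale1r.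
have cB S' T' : conj_op g S' - conj_op g T' = conj_op g (S' - T').
  by rewrite addrC -scaleN1r -conj_opP scaleN1r addrC.
have cZ a T' : a *: conj_op g T' = conj_op g (a *: T').
  by apply/funext => x; rewrite /conj_op [RHS](lin_Z (unitary_linear _)).
by rewrite /hs_form !cZ !cD !cB !hs_sq_conj_op.
Qed.

Definition hs_conj g (t : HS) : HS := Sub (conj_op g (\val t)) (conj_op_hs g (valP t)).

Lemma hs_conj_linear g : linear (hs_conj g).
Proof. by move=> a s t; apply: val_inj; rewrite /= conj_opP. Qed.

Lemma hs_conj_inner g s t : inner (hs_conj g s) (hs_conj g t) = inner s t.
Proof. exact: hs_form_conj_op. Qed.

Lemma hs_conjM g h t : hs_conj (g * h)%g t = hs_conj g (hs_conj h t).
Proof.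
by apply/val_inj/funext => x /=; rewrite /conj_op /= invgM !rhoM.
Qed.

Lemma hs_conj1 t : hs_conj 1%g t = t.
Proof. by apply/val_inj/funext => x /=; rewrite /conj_op invg1 !rho1. Qed.

Lemma hs_conj_surj g t : exists s, hs_conj g s = t.
Proof. by exists (hs_conj g^-1%g t); rewrite -hs_conjM mulgV hs_conj1. Qed.

Definition hs_rep g : unitary HS :=
  Unitary (hs_conj_linear g) (hs_conj_inner g) (hs_conj_surj g).

Lemma hs_repM : {morph hs_rep : g h / (g * h)%g}.
Proof. by move=> g h; apply: unitary_ext => t; exact: hs_conjM. Qed.

HB.instance Definition _ := isMultiplicative.Build G (unitary HS) hs_rep hs_repM.

Lemma nsq_hsE (t : HS) : nsq t = hs_sq (\val t).
Proof.
apply: complexI; rewrite -nsqE.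
by rewrite [LHS](hs_formxx (valP t)).
Qed.

(** This Lipschitz bound in the operator norm is what makes conjugation continuous; the factor 4
    comes from splitting the difference in two by [energyD]. *)
Lemma hs_rep_dist g h (t : HS) :
  nsq (hs_rep g t - hs_rep h t) <= 4 * unitary_dist (rho g) (rho h) ^+ 2 * nsq t.
Proof.
rewrite !nsq_hsE; set T := \val t; set d := unitary_dist _ _.
have Th : T \in hs_pred Z by exact: valP.
rewrite [X in hs_sq X](_ : _ = conj_op g T - conj_op h T)//.
apply: hs_sq_le => f.
(* [A] changes the outer factor, [B] the inner one. The adjoint of [rho g^-1 - rho h^-1] is
   [rho g - rho h], so the same distance controls both. *)
pose A x := (fun y => rho g y - rho h y) (T (rho g^-1%g x)).
pose B x := rho h (T (rho g^-1%g x - rho h^-1%g x)).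
have -> : conj_op g T - conj_op h T = (fun x => A x + B x).
  apply/funext => x; rewrite /A /B (lin_B (hs_linear Th)) (lin_B (unitary_linear _)).
  by rewrite subrKA.
have -> : 4 * d ^+ 2 * hs_sq T = 2 * (d ^+ 2 * hs_sq T) + 2 * (d ^+ 2 * hs_sq T) by ring.
rewrite (le_trans (energyD f A B))// lerD// ler_pM2l//.
  rewrite (@le_trans _ _ (d ^+ 2 * energy (onfam_rho g^-1%g f) T))//.
    by rewrite /energy mulr_sumr; apply: ler_sum => i _; exact: nsq_unitary_dist.
  by rewrite ler_wpM2l ?sqr_ge0// (energy_le_hs _ Th).
have [|k|k] := @energy_comp_right R V T (fun x => rho g^-1%g x - rho h^-1%g x)
    (fun x => rho g x - rho h x) (d ^+ 2) f (hs_linear Th).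
- by move=> x y; rewrite innerBl innerBr !rho_adjoint !invgK.
- exact: nsq_unitary_dist.
rewrite /energy; under [X in _ -> X <= _]eq_bigr do rewrite nsq_unitary.
by move/le_trans; apply; rewrite ler_wpM2l ?sqr_ge0// (energy_le_hs _ Th).
Qed.

End ConjugationRep.

(** * Almost invariant vectors *)

Section DiagonalOperators.
Variables (R : realType) (V : hilbertType R).
Implicit Types (x y : V).

Lemma csq_innerC x y : csq (inner x y) = csq (inner y x).
Proof. by rewrite innerC csq_conj. Qed.

Lemma conj_real (a : R) : Num.conj a%:C = a%:C.
Proof. exact: conjc_real. Qed.

Lemma csqM_real (a : R) (z : R[i]) : csq (a%:C * z) = a ^+ 2 * csq z.
Proof. by case: z => b c; rewrite /csq /= mul0r mul0r subr0 addr0 !exprMn mulrDr. Qed.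

Definition diag_op n (h : 'I_n -> V) (g : 'I_n -> R) x :=
  \sum_k ((g k)%:C * inner x (h k)) *: h k.

Section Diag.
Variables (n : nat) (h : 'I_n -> V) (g : 'I_n -> R).
Hypothesis ho : orthonormal_fam h.

Lemma diag_op_linear : linear (diag_op h g).
Proof.
move=> a x y; rewrite /diag_op scaler_sumr -big_split; apply: eq_bigr => k _ /=.
by rewrite innerDl innerZl mulrDr scalerDl scalerA mulrCA.
Qed.

Lemma diag_op_sym x y : inner (diag_op h g x) y = inner x (diag_op h g y).
Proof.
rewrite inner_suml inner_sumr; apply: eq_bigr => k _.
rewrite innerZl innerZr rmorphM/= -innerC conj_real.
by rewrite mulrAC.
Qed.

Lemma Re_inner_diag_op x : complex.Re (inner (diag_op h g x) x) =
  \sum_k g k * csq (inner x (h k)).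
Proof.
rewrite inner_suml Re_sum; apply: eq_bigr => k _.
rewrite innerZl (innerC (h k)) -mulrA -normCK -csqE ReM_real.
by [].
Qed.

Lemma nsq_diag_op x : nsq (diag_op h g x) = \sum_k g k ^+ 2 * csq (inner x (h k)).
Proof.
rewrite /diag_op (nsq_sum_fam ho); apply: eq_bigr => k _.
exact: csqM_real.
Qed.

Lemma diag_op_h k : diag_op h g (h k) = (g k)%:C *: h k.
Proof.
rewrite /diag_op (bigD1 k)//= ho eqxx mulr1 big1 ?addr0// => j jk.
by rewrite ho eq_sym (negPf jk) mulr0 scale0r.
Qed.

Lemma energy_diag_op (f : onfam V) : energy f (diag_op h g) <= \sum_k g k ^+ 2.
Proof.
rewrite /energy; under eq_bigr do rewrite nsq_diag_op.
rewrite exchange_big/=; apply: ler_sum => k _; rewrite -mulr_sumr.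
have h1 : nsq (h k) = 1 by apply: complexI; rewrite -nsqE ho eqxx.
rewrite -[leRHS]mulr1 ler_wpM2l ?sqr_ge0// -h1.
under eq_bigr do rewrite csq_innerC.
exact: bessel (@onfamP _ _ f) _.
Qed.

End Diag.

(* The trace inequality of Powers and Stormer: [|b - a|_HS^2] is at most the trace
   of [sgn(b - a) (b^2 - a^2)]. *)
Lemma powers_stormer n (h : 'I_n -> V) (g : 'I_n -> R) (a b : V -> V) :
  orthonormal_fam h -> (forall k, b (h k) - a (h k) = (g k)%:C *: h k) ->
  (forall x, 0 <= complex.Re (inner (a x) x)) ->
  (forall x, 0 <= complex.Re (inner (b x) x)) ->
  \sum_k g k ^+ 2 <= \sum_k Num.sg (g k) * (nsq (b (h k)) - nsq (a (h k))).
Proof.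
move=> ho bag a0 b0; apply: ler_sum => k _.
have h1 : inner (h k) (h k) = 1 by rewrite ho eqxx.
have bE : b (h k) = a (h k) + (g k)%:C *: h k by rewrite -bag addrC subrK.
have := a0 (h k); have := b0 (h k).
rewrite bE nsqD nsqZ innerDl innerZl innerZr conj_real ReM_real h1 mulr1.
rewrite ReD /= /nsq h1 /= mulr1 {1}/csq /= expr0n addr0.
set t := complex.Re _ => bg ag.
(* Positivity of [a] and [b] at [h k] reads [0 <= t] and [0 <= t + g k]; together these give
   [|g k| <= g k + 2 * t]. *)
have -> : Num.sg (g k) * (nsq (a (h k)) + g k ^+ 2 + 2 * (g k * t) - nsq (a (h k))) =
    `|g k| * (g k + 2 * t).
  by rewrite normrEsg; ring.
rewrite -[leLHS]real_normK ?num_real// expr2 ler_wpM2l// ler_norml.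
by apply/andP; split; lra.
Qed.

End DiagonalOperators.

Section SquareRoot.
Variables (R : realType) (V : hilbertType R).
Implicit Types (x y : V).

(** The roots of the eigenvalues of the positive finite-rank operator [S] below give its square
    root, whose squared norm at [x] is the inner product of [S x] with [x]. The last equation
    computes the trace of [S] in two ways. *)
Lemma density_sqrt (s : seq (R * V)) : all (fun p => 0 <= p.1) s ->
  exists n (h : 'I_n -> V) (g : 'I_n -> R), [/\ orthonormal_fam h,
    forall k, 0 <= g k,
    forall x, nsq (diag_op h g x) = \sum_(p <- s) p.1 * csq (inner x p.2) &
    \sum_k g k ^+ 2 = \sum_(p <- s) p.1 * nsq p.2].
Proof.
move=> s0; have [n [e [eo es]]] := gram_schmidt [seq p.2 | p <- s].
pose S x := \sum_(p <- s) (p.1%:C * inner x p.2) *: p.2.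
have Sl : linear S.
  move=> a x y; rewrite /S scaler_sumr -big_split; apply: eq_bigr => p _ /=.
  by rewrite innerDl innerZl mulrDr scalerDl scalerA mulrCA.
have Se x : proj_fam e (S x) = S x.
  rewrite (lin_comb (proj_fam_linear e)) big_seq [RHS]big_seq.
  by apply: eq_bigr => p ps; rewrite es//; exact: map_f.
have Ssym x y : inner (S x) y = inner x (S y).
  rewrite inner_suml inner_sumr; apply: eq_bigr => p _.
  by rewrite innerZl innerZr rmorphM/= -innerC conj_real mulrAC.
have SE x : inner (S x) x = (\sum_(p <- s) p.1 * csq (inner x p.2))%:C.
  rewrite inner_suml real_sum; apply: eq_bigr => p _.
  by rewrite innerZl (innerC p.2) -mulrA -normCK -csqE rmorphM.
have [h [l [ho hP hS]]] := spectral_fam Sl eo Se Ssym.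
have hSx x : proj_fam h (S x) = S x by rewrite hP.
have SDiag := spectral_famE ho hSx Ssym hS.
have h1 k : inner (h k) (h k) = 1 by rewrite ho eqxx.
have lE k : l k = \sum_(p <- s) p.1 * csq (inner (h k) p.2).
  by apply: complexI; rewrite -SE hS innerZl h1 mulr1.
have l0 k : 0 <= l k.
  rewrite lE big_seq; apply: sumr_ge0 => p ps.
  by rewrite mulr_ge0 ?csq_ge0//; move/allP: s0; exact.
exists n, h, (fun k => Num.sqrt (l k)); split=> //.
- move=> x; rewrite nsq_diag_op//; under eq_bigr do rewrite sqr_sqrtr//.
  apply: complexI; rewrite -SE SDiag -Re_inner_diag_op /diag_op.
  by rewrite -SDiag RRe_real// SE complex_real.
(* The trace is taken in [h]; Parseval applies to each [p.2] because it lies in the span of [h]. *)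
- under eq_bigr do rewrite sqr_sqrtr// lE.
  rewrite exchange_big/= big_seq [RHS]big_seq; apply: eq_bigr => p ps.
  rewrite -mulr_sumr; congr (_ * _); under eq_bigr do rewrite csq_innerC.
  rewrite -(nsq_sum_fam ho) -/(proj_fam h p.2) hP es//; exact: map_f.
Qed.

End SquareRoot.

Section AlmostInvariant.
Variables (R : realType) (V : hilbertType R) (G : topGroupType)
  (rho : {multiplicative G -> unitary V}) (Z : set V) (x0 : V).
Hypotheses (ZG : forall g z, Z z -> Z (rho g z)) (rhoc : continuous rho)
  (amG : amenable R G) (x01 : nsq x0 = 1) (Zx0 : forall z, Z z -> inner z x0 = 0).
Implicit Types (x y : V).

Lemma nbhs_rho g d : 0 < d -> \forall h \near g, unitary_dist (rho g) (rho h) < d.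
Proof.
move=> d0; have H : nbhs (rho g) [set v | unitary_dist (rho g) v < d].
  by apply/nbhs_ballP; exists d.
exact: (@rhoc g _ H).
Qed.

(** Young's inequality with a free weight, so that the coefficient of [csq p] can be taken close to
    1. *)
Lemma csqD_le (t : R) (p q : R[i]) : 0 < t ->
  csq (p + q) <= (1 + t) * csq p + (1 + t^-1) * csq q.
Proof.
move=> t0; have H (a b : R) : (a + b) ^+ 2 <= (1 + t) * a ^+ 2 + (1 + t^-1) * b ^+ 2.
  rewrite -subr_ge0 (_ : _ - _ = t * (a - t^-1 * b) ^+ 2).
    by rewrite mulr_ge0 ?sqr_ge0// ltW.
  by field; rewrite gt_eqF.
case: p q => [a b] [c d]; rewrite /csq /=; have := H a c; have := H b d; lra.
Qed.

(* [sign_form] is the quadratic form of the partial isometry [sgn c], where [c] is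
   the operator with eigenvectors [projT1 i] and eigenvalues [projT2 i]. *)
Definition sign_test := {f : onfam V & 'I_(onfam_size f) -> R}.

Definition sign_form (i : sign_test) x : R :=
  \sum_k Num.sg (projT2 i k) * csq (inner x (projT1 i k)).

Lemma normr_sg_le1 (a : R) : `|Num.sg a| <= 1.
Proof. by rewrite normr_sg; case: (a == 0); rewrite ?ler01. Qed.

Lemma sign_form_le i x : `|sign_form i x| <= nsq x.
Proof.
rewrite (le_trans (ler_norm_sum _ _ _))//.
rewrite (le_trans _ (bessel (@onfamP _ _ (projT1 i)) x))//; apply: ler_sum => k _.
by rewrite normrM (ger0_norm (csq_ge0 _)) ler_piMl ?csq_ge0 ?normr_sg_le1.
Qed.

(** [csqD_le] is applied to each coordinate in both directions, and Bessel's inequality sums up. The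
    bound does not involve the test [i], and [t] can be fixed before [x - y] is made small. *)
Lemma sign_form_dist i (t : R) x y : 0 < t ->
  `|sign_form i x - sign_form i y| <=
    t * (nsq x + nsq y) + 2 * (1 + t^-1) * nsq (x - y).
Proof.
move=> t0; rewrite -sumrB (le_trans (ler_norm_sum _ _ _))//.
have ho := @onfamP _ _ (projT1 i).
apply: (@le_trans _ _ (\sum_k (t * (csq (inner x (projT1 i k)) + csq (inner y (projT1 i k))) +
    2 * (1 + t^-1) * csq (inner (x - y) (projT1 i k))))).
  apply: ler_sum => k _; rewrite -mulrBr normrM.
  rewrite (@le_trans _ _ `|csq (inner x (projT1 i k)) - csq (inner y (projT1 i k))|)//.
    by rewrite ler_piMl ?normr_sg_le1.
  set p := inner x _; set q := inner y _; rewrite innerBl -/p -/q.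
  have := csqD_le q (p - q) t0; rewrite addrC subrK => pq.
  have := csqD_le p (q - p) t0; rewrite addrC subrK => qp.
  have qpE : csq (q - p) = csq (p - q).
    by case: (p) (q) => [a b] [c d]; rewrite /csq /=; ring.
  rewrite {}qpE in qp.
  have := csq_ge0 p; have := csq_ge0 q; have := csq_ge0 (p - q).
  have tp : 0 < t^-1 by rewrite invr_gt0.
  move: (csq p) (csq q) (csq (p - q)) pq qp => a b c pq qp c0 b0 a0.
  by rewrite ler_norml; apply/andP; split; nra.
rewrite big_split/= -!mulr_sumr lerD//.
  by rewrite ler_wpM2l ?(ltW t0)// big_split lerD//; exact: bessel.
rewrite ler_wpM2l ?bessel// mulr_ge0// addr_ge0// invr_ge0 ltW//.
Qed.

(** The factor [h] is isometric and [l] preserves the norm of [x0], so the displacement is at most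
    the operator norm of [rho k - 1], uniformly in [h] and [l]. Strong continuity would not give
    uniformity in [l]. *)
Lemma sign_form_equicontinuous (e : R) : 0 < e -> nbhs (1%g : G) [set k |
  forall i h l, `|sign_form i (rho (h * k * l)%g x0) - sign_form i (rho (h * l)%g x0)| <= e].
Proof.
(* For two unit vectors the first term of [sign_form_dist] is [2 * t], that is [e / 2]; the radius
   in [d0] makes the second at most [e / 2]. *)
move=> e0; pose t := e / 4; have t0 : 0 < t by rewrite divr_gt0.
pose c := 2 * (1 + t^-1); have c0 : 0 < c by rewrite mulr_gt0// addr_gt0// invr_gt0.
have d0 : 0 < Num.sqrt (e / 2 / c) by rewrite sqrtr_gt0 !divr_gt0.
apply: filterS (nbhs_rho 1%g d0) => k kd i h l.
apply: le_trans (sign_form_dist _ _ _ t0) _.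
rewrite !nsq_unitary x01.
have : nsq (rho (h * k * l)%g x0 - rho (h * l)%g x0) <= e / 2 / c.
  rewrite !rhoM -(lin_B (unitary_linear _)) nsq_unitary -nsqN opprB.
  rewrite -{1}(rho1 rho (rho l x0)) (le_trans (nsq_unitary_dist _ _ _))//.
  rewrite nsq_unitary x01 mulr1 -[leRHS]sqr_sqrtr; last by rewrite !divr_ge0// ltW.
  rewrite ler_pXn2r ?nnegrE ?sqrtr_ge0 ?unitary_dist_ge0//; exact: ltW.
rewrite ler_pdivlMr// mulrC -/c => H.
rewrite (le_trans (lerD (lexx _) H))// /t.
by lra.
Qed.

(* [diag_op h g] is the square root of [\sum_(p <- s) p.1 (rho p.2 x0 (x) rho p.2 x0)]. *)
Lemma sqrt_vector (s : seq (R * G)) : all (fun p => 0 <= p.1) s ->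
    \sum_(p <- s) p.1 = 1 ->
  exists n (h : 'I_n -> V) (g : 'I_n -> R), [/\ orthonormal_fam h, forall k, 0 <= g k,
    forall x, nsq (diag_op h g x) = \sum_(p <- s) p.1 * csq (inner x (rho p.2 x0)),
    diag_op h g \in hs_pred Z & hs_sq (diag_op h g) = 1].
Proof.
move=> s0 s1; pose s' := [seq (p.1, rho p.2 x0) | p <- s].
have [|n [h [g [ho g0 nE gE]]]] := @density_sqrt R V s'.
  by rewrite all_map; apply: sub_all s0 => p.
have gs : \sum_k g k ^+ 2 = 1.
  rewrite gE big_map -s1; apply: eq_bigr => p _ /=.
  by rewrite nsq_unitary x01 mulr1.
have hsP : diag_op h g \in hs_pred Z.
  apply/asboolP; split; first exact: diag_op_linear.
    by exists (\sum_k g k ^+ 2) => f; exact: energy_diag_op.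
  move=> z Zz; apply/eqP; rewrite -nsq_eq0 nE big_map big1// => p _ /=.
  (* [rho p.2] moves across the inner product and its inverse preserves [Z], so every translate of
     [x0] is orthogonal to [Z]. *)
  by rewrite -(rhoVK rho p.2 z) unitary_inner Zx0 ?csq0 ?mulr0//; exact: ZG.
exists n, h, g; split=> //; first by move=> x; rewrite nE big_map.
apply/eqP; rewrite eq_le; apply/andP; split.
  by apply: hs_sq_le => f; rewrite -gs energy_diag_op.
(* The value 1 is already reached on the eigenbasis [h]. *)
rewrite (le_trans _ (energy_le_hs (OnFam ho) hsP))//= -gs.
apply: ler_sum => k _ /=; rewrite diag_op_h// nsqZ.
rewrite (_ : nsq (h k) = 1) ?mulr1; last by apply: complexI; rewrite -nsqE ho eqxx.
by rewrite /csq /= expr0n addr0.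
Qed.

Lemma finite_almost_invariant n (k : 'I_n -> G) (e : R) : 0 < e ->
  exists t : hilbert_of (hs_data Z), nsq t = 1 /\
    forall j, nsq (hs_rep ZG (k j) t - t) <= e.
Proof.
move=> e0; have u1 i h : `|sign_form i (rho h x0)| <= 1.
  by rewrite -x01 -(nsq_unitary (rho h)) sign_form_le.
have [s [s0 s1 sU]] := reiter amG u1 sign_form_equicontinuous k e0.
have [m [h [l [ho l0 aE aH a1]]]] := sqrt_vector s0 s1.
set a := diag_op h l in aE aH a1.
pose t : hilbert_of (hs_data Z) := Sub a aH.
exists t; split; first by rewrite nsq_hsE.
move=> j; pose b := conj_op rho (k j) a.
rewrite nsq_hsE [X in hs_sq X](_ : _ = b - a)//.
have bH : b \in hs_pred Z by exact: conj_op_hs.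
have cH : b - a \in hs_pred Z by exact: rpredB.
have a0 x : 0 <= complex.Re (inner (a x) x).
  by rewrite Re_inner_diag_op; apply: sumr_ge0 => i _; rewrite mulr_ge0 ?csq_ge0.
have bE x : inner (b x) x = inner (a (rho (k j)^-1%g x)) (rho (k j)^-1%g x).
  exact: rho_adjoint.
have b0 x : 0 <= complex.Re (inner (b x) x) by rewrite bE.
have csym x y : inner ((b - a) x) y = inner x ((b - a) y).
  rewrite [LHS]innerBl [RHS]innerBr; congr (_ - _); last exact: diag_op_sym.
  by rewrite /b /conj_op rho_adjoint diag_op_sym rho_adjoint invgK.
(* A finite family whose span contains the ranges of [a] and [b], so that [b - a] can be
   diagonalised. *)
have [q [f [fo fs]]] := gram_schmidt (codom h ++ codom (fun i => rho (k j) (h i))).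
have aL (y : 'I_m -> V) x : (forall i, proj_fam f (y i) = y i) ->
    proj_fam f (diag_op y l x) = diag_op y l x.
  move=> yf; rewrite /diag_op (lin_comb (proj_fam_linear f)).
  by apply: eq_bigr => i _; rewrite yf.
have cf x : proj_fam f ((b - a) x) = (b - a) x.
  rewrite [(b - a) x]/(b x - a x) (lin_B (proj_fam_linear f)); congr (_ - _).
    have -> : b x = \sum_i ((l i)%:C * inner (rho (k j)^-1%g x) (h i)) *: rho (k j) (h i).
      by rewrite /b /conj_op /a /diag_op (lin_comb (unitary_linear _)).
    rewrite (lin_comb (proj_fam_linear f)); apply: eq_bigr => i _; rewrite fs//.
    by rewrite mem_cat codom_f orbT.
  by apply: aL => i; rewrite fs// mem_cat codom_f.
have [f' [g [fo' fP' fE']]] := spectral_fam (hs_linear cH) fo cf csym.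
have cf' x : proj_fam f' ((b - a) x) = (b - a) x by rewrite fP'.
have cE : b - a = diag_op f' g by apply/funext; exact: spectral_famE.
have hsc : hs_sq (b - a) <= \sum_i g i ^+ 2.
  by rewrite cE; apply: hs_sq_le => v; exact: energy_diag_op.
apply: (le_trans hsc); apply: (le_trans (powers_stormer fo' fE' a0 b0)).
(* The test is the sign of [b - a], which depends on [s]; this is why [reiter] bounds the drift for
   all tests with one [s]. The right side of [powers_stormer] is exactly this drift. *)
have := sU j (existT (fun f : onfam V => 'I_(onfam_size f) -> R) (OnFam fo') g).
apply: le_trans; rewrite le_eqVlt; apply/orP; left; apply/eqP.
have nb x : nsq (b x) = \sum_(p <- s) p.1 * csq (inner x (rho (k j * p.2)%g x0)).
  rewrite nsq_unitary aE; apply: eq_bigr => p _.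
  by rewrite rhoM -{2}(rhoVK rho (k j) x) unitary_inner.
under eq_bigr do rewrite nb aE -sumrB mulr_sumr.
rewrite exchange_big/=; apply: eq_bigr => p _.
rewrite /sign_form -sumrB mulr_sumr; apply: eq_bigr => i _ /=.
by rewrite !(csq_innerC _ (f' i)); ring.
Qed.

End AlmostInvariant.

(** * From property (T) to an invariant operator *)

Section InvariantOperator.
Variables (R : realType) (V : hilbertType R) (G : topGroupType)
  (rho : {multiplicative G -> unitary V}) (Z : set V) (x0 : V).
Hypotheses (ZG : forall g z, Z z -> Z (rho g z)) (rhoc : continuous rho)
  (amG : amenable R G) (pT : property_T R G)
  (x01 : nsq x0 = 1) (Zx0 : forall z, Z z -> inner z x0 = 0).

Lemma hs_rep_strongly_continuous : strongly_continuous (hs_rep ZG).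
Proof.
move=> t g; apply/cvgrPdist_lt => e e0.
have eE : (complex.Re e)%:C = e by rewrite RRe_real// gtr0_real.
have e0' : 0 < complex.Re e by rewrite -ltcR eE.
set d := complex.Re e in eE e0'.
have c0 : 0 < 4 * nsq t + 1 by rewrite ltr_wpDl// mulr_ge0// nsq_ge0.
have d0 : 0 < Num.sqrt (d ^+ 2 / (4 * nsq t + 1)) by rewrite sqrtr_gt0 divr_gt0// exprn_gt0.
apply: filterS (nbhs_rho rhoc g d0) => h gh; rewrite -eE norm_lt_nsq; last exact: ltW.
apply: le_lt_trans (hs_rep_dist ZG g h t) _.
have : unitary_dist (rho g) (rho h) ^+ 2 < d ^+ 2 / (4 * nsq t + 1).
  rewrite -[ltRHS]sqr_sqrtr; last by rewrite divr_ge0 ?exprn_ge0 ?ltW.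
  by rewrite ltr_pXn2r ?nnegrE ?unitary_dist_ge0 ?sqrtr_ge0.
rewrite ltr_pdivlMr// mulrDr mulr1 => H.
have := sqr_ge0 (unitary_dist (rho g) (rho h)).
move: (nsq t) (unitary_dist _ _ ^+ 2) H => a b H b0; lra.
Qed.

Lemma hs_rep_almost_invariant : almost_invariant_vectors (hs_rep ZG).
Proof.
move=> e K e0 Kc.
pose G' := HB.pack_for ptopologicalType (TopGroup.sort G) (isPointed.Build (TopGroup.sort G) 1%g).
have Kcpt : @cover_compact G' K by rewrite -compact_cover.
have d0 : 0 < e / 4 by rewrite divr_gt0.
pose B (g : G) := [set h | unitary_dist (rho g) (rho h) < e / 4]°.
have [|g _|D _ KD] := Kcpt G setT B.
- by move=> g _; exact: open_interior.
- by exists g => //; exact: nbhs_rho.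
pose s : seq G := finmap.enum_fset D.
pose k (j : 'I_(size s)) : G := nth 1%g s j.
(* Together with the net of radius [e / 4] this gives the bound
   [2 * (e ^+ 2 / 8) + 2 * 4 * (e / 4) ^+ 2], which is three quarters of [e ^+ 2]. *)
have e80 : 0 < e ^+ 2 / 8 by rewrite divr_gt0// exprn_gt0.
have [t [t1 tk]] := finite_almost_invariant ZG rhoc amG x01 Zx0 k e80.
exists t; split; first exact/norm1_nsq.
move=> h /KD[g gD /interior_subset /= gh]; rewrite norm_lt_nsq; last exact: ltW.
have gs : (index g s < size s)%N by rewrite index_mem.
have := tk (Ordinal gs); rewrite /k nth_index// => tg.
rewrite -(subrKA (hs_rep ZG g t)) (le_lt_trans (nsqD_le _ _))//.
have -> : nsq (t - hs_rep ZG g t) = nsq (hs_rep ZG g t - t) by rewrite -nsqN opprB.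
have := hs_rep_dist ZG g h t; rewrite t1 mulr1 => dg.
have du : unitary_dist (rho g) (rho h) ^+ 2 < (e / 4) ^+ 2.
  by rewrite ltr_pXn2r ?nnegrE ?unitary_dist_ge0// ltW.
have e4 : (e / 4) ^+ 2 = e ^+ 2 / 16 by field.
have e2 : 0 < e ^+ 2 by rewrite exprn_gt0.
rewrite -[hs_conj ZG h t]/(hs_rep ZG h t).
rewrite e4 in du; move: (nsq _) (nsq _) (unitary_dist _ _ ^+ 2) (e ^+ 2) tg dg du e2.
by move=> p q u v; lra.
Qed.

Lemma invariant_hs_operator : exists T : V -> V,
  [/\ T \in hs_pred Z, exists x, T x <> 0 & forall g x, T (rho g x) = rho g (T x)].
Proof.
have [t [t1 tG]] := pT hs_rep_strongly_continuous hs_rep_almost_invariant.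
exists (\val t); split; first exact: valP.
  apply: contrapT => /forallNP T0.
  have : nsq t = 1 by exact/norm1_nsq.
  rewrite (_ : t = 0) ?nsq0; first by move/eqP; rewrite eq_sym oner_eq0.
  by apply/val_inj/funext => x; exact: contrapT (T0 x).
move=> g x; have /(congr1 \val) /= /(congr1 (@^~ (rho g x))) := tG g.
by rewrite /conj_op rhoK.
Qed.

End InvariantOperator.

(** * The top singular space *)

(** Compactness of the interval from [- M] to [M] gives a cluster point, and an ultrafilter
    converges to its cluster points. *)
Lemma ultra_bounded (R : realType) (T : Type) (U : set_system T) (M d : R) (phi : T -> R) :
  UltraFilter U -> 0 < d -> U [set x | `|phi x| <= M] ->
  exists p, U [set x | `|p - phi x| < d].
Proof.
move=> UU d0 UM.
have PF := @ultra_proper _ _ UU.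
have [|p [_ pc]] := @segment_compact R (- M) M (phi @ U) (fmap_proper_filter _ PF).
  change (U (phi @^-1` [set` `[- M, M]])); apply: filterS UM => x.
  by rewrite /= in_itv/= ler_norml.
exists p; have [//|UC] := in_ultra_setVsetC [set x | `|p - phi x| < d] UU.
have [_ [[x xC <-] /= xd]] : (phi @` (~` [set x | `|p - phi x| < d]) `&` ball p d) !=set0.
  apply: pc; last exact: nbhsx_ballx.
  change (U (phi @^-1` (phi @` (~` [set x | `|p - phi x| < d])))).
  by apply: filterS UC => x xC; exists x.
by exfalso; apply: xC; move: xd; rewrite /ball/=.
Qed.

Section TopEigenspace.
Variables (R : realType) (V : hilbertType R) (Z : set V) (T : V -> V).
Hypothesis TH : T \in hs_pred Z.
Implicit Types x y w : V.

Let Tl : linear T := hs_linear TH.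

Lemma hs_cvg (F : set_system V) w : Filter F -> F --> w -> T @ F --> T w.
Proof.
move=> FF /cvgrPdist_lt Fw; apply/cvgrPdist_lt => e e0.
have eE : (complex.Re e)%:C = e by rewrite RRe_real// gtr0_real.
have e0' : 0 < complex.Re e by rewrite -ltcR eE.
set d := complex.Re e in eE e0'.
have c0 : 0 < hs_sq T + 1 by rewrite ltr_wpDl// (hs_sq_ge0 TH).
have d0 : 0 < d ^+ 2 / (hs_sq T + 1) by rewrite divr_gt0// exprn_gt0.
have s0 : 0 < (Num.sqrt (d ^+ 2 / (hs_sq T + 1)))%:C :> R[i] by rewrite ltcR sqrtr_gt0.
apply: filterS (Fw _ s0) => x; rewrite -eE !norm_lt_nsq ?sqrtr_ge0 ?(ltW e0')//.
rewrite sqr_sqrtr ?(ltW d0)// ltr_pdivlMr// mulrC => H.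
rewrite -(lin_B Tl) (le_lt_trans (nsq_hs _ TH))// (le_lt_trans _ H)//.
by rewrite ler_wpM2r ?nsq_ge0// lerDl.
Qed.

Definition top_sq : R := sup [set nsq (T x) | x in [set x | nsq x <= 1]].

Let top_ub x : nsq x <= 1 -> nsq (T x) <= top_sq.
Proof.
move=> x1; apply: ub_le_sup; last by exists x.
exists (hs_sq T) => _ [y y1 <-]; rewrite (le_trans (nsq_hs _ TH))//.
by rewrite ler_piMr// (hs_sq_ge0 TH).
Qed.

Lemma nsq_top x : nsq (T x) <= top_sq * nsq x.
Proof.
have [->|x0] := eqVneq x 0; first by rewrite (lin_0 Tl) nsq0 mulr0.
have [a a1 xE] := normalize x0.
rewrite xE (lin_Z Tl) !(nsqZ a^-1) mulrCA ler_wpM2l ?csq_ge0// a1 mulr1.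
by rewrite top_ub// a1.
Qed.

(** The eigenspace of the adjoint of [T] times [T] for the top eigenvalue. This form avoids the
    adjoint, and invariance under unitaries commuting with [T] is immediate from it. *)
Definition top_space : {pred V} := fun x => top_sq * nsq x == nsq (T x).

(** [top_sq * nsq x - nsq (T x)] is nonnegative and obeys the parallelogram law; vanishing at
    [a *: x] and [y], it vanishes at their sum. *)
Lemma top_space_submod : submod_closed top_space.
Proof.
split; first by rewrite unfold_in (lin_0 Tl) nsq0 mulr0.
move=> a x y; rewrite !unfold_in => /eqP xW /eqP yW.
rewrite eq_le nsq_top andbT -subr_le0.
have := nsq_top (a *: x - y).
have := parallelogram (a *: x) y; have := parallelogram (T (a *: x)) (T y).
rewrite -(lin_D Tl) -(lin_B Tl) (lin_Z Tl) !nsqZ -xW -yW => TP P.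
have : top_sq * (nsq (a *: x + y) + nsq (a *: x - y)) = top_sq * (2 * (csq a * nsq x) + 2 * nsq y).
  by rewrite P.
move: TP; rewrite mulrDr; lra.
Qed.

Lemma top_space_closed : closed [set x | x \in top_space].
Proof.
rewrite (_ : [set x | x \in top_space] =
    [set x | top_sq * nsq x - nsq (T x) <= 0]); last first.
  by apply/funext => x; apply/propext; rewrite /= unfold_in subr_le0 eq_le nsq_top andbT.
apply: closed_continuous_le => x.
apply: cvgB; first by apply: cvgMr; exact: (@cvg_nsq R V V (nbhs x) id).
by apply: cvg_nsq; exact: hs_cvg.
Qed.

(** A unit vector orthogonal to [f] can be added to it, and the energy can grow by at most [e]
    before exceeding [hs_sq T]. *)
Lemma onfam_orthogonal_small (f : onfam V) (e : R) x :
  hs_sq T - e <= energy f T -> nsq (T (x - proj_fam f x)) <= e * nsq x.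
Proof.
move=> fe; have e0 : 0 <= e by have := energy_le_hs f TH; lra.
set y := x - _.
have yx : nsq y <= nsq x.
  by rewrite [leRHS](nsq_proj_fam (@onfamP _ _ f)) lerDl; apply: sumr_ge0 => i _; exact: csq_ge0.
apply: (@le_trans _ _ (e * nsq y)); last by rewrite ler_wpM2l.
have [->|y0] := eqVneq y 0; first by rewrite (lin_0 Tl) nsq0 mulr0.
have [a a1 yE] := normalize y0.
have ae i : inner (a *: y) (f i) = 0.
  by rewrite innerZl innerBl (inner_proj_fam_h (@onfamP _ _ f)) subrr mulr0.
have := energy_le_hs (OnFam (fam_cons_orthonormal (@onfamP _ _ f) a1 ae)) TH.
rewrite {1}/energy/= (fam_cons_sum f (a *: y) (fun z => nsq (T z))) -/(energy f T).
rewrite {2 3}yE (lin_Z Tl (a^-1)) !(nsqZ a^-1) a1 mulr1 mulrC => H.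
by rewrite ler_wpM2r ?csq_ge0//; lra.
Qed.

Hypothesis T0 : exists x, T x <> 0.

Lemma top_sq_gt0 : 0 < top_sq.
Proof.
have [x Tx0] := T0; have := nsq_top x; apply: contraTT; rewrite -leNgt -ltNge => t0.
apply: (@le_lt_trans _ _ 0); first by rewrite mulr_le0_ge0 ?nsq_ge0.
by rewrite lt_def nsq_ge0 andbT nsq_eq0; apply/eqP.
Qed.

(* Take an ultrafilter containing the almost maximizing vectors. Since [T] is small
   off a finite orthonormal family, the ultrafilter is Cauchy for [|T (x - y)|], and
   then for [|x - y|] by the parallelogram identity. *)
Lemma top_space_neq0 : exists2 w, w \in top_space & w != 0.
Proof.
pose B e := [set x | nsq x <= 1 /\ top_sq - e <= nsq (T x)].
pose F : set_system V := [set A | exists2 e : R, 0 < e & B e `<=` A].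
have FP : ProperFilter F.
  apply: Build_ProperFilter.
    move=> [e e0 B0].
    have : top_sq - e < top_sq by rewrite ltrBlDr ltrDl.
    move=> /(sup_gt _)[|_ [x x1 <-] xe].
      by exists (nsq (T 0)), 0; rewrite //= nsq0.
    by apply: (B0 x); split=> //; exact: ltW.
  split; first by exists 1.
  - move=> A A' [e e0 BA] [e' e'0 BA']; exists (Num.min e e'); first by rewrite lt_min e0.
    move=> x [x1 xe]; split; [apply: BA|apply: BA']; split=> //; apply: le_trans xe.
      by rewrite lerD2l lerN2 ge_min lexx.
    by rewrite lerD2l lerN2 ge_min lexx orbT.
  - by move=> A A' AA' [e e0 BA]; exists e => // x /BA/AA'.
have [U [UU FU]] := ultraFilterLemma FP.
have PU := @ultra_proper _ _ UU.
have UB e : 0 < e -> U (B e) by move=> e0; apply: FU; exists e.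
have Tc e : 0 < e -> exists2 A, U A & forall x y, A x -> A y -> nsq (T (x - y)) <= e.
  move=> e0; have e160 : 0 < e / 16 by rewrite divr_gt0.
  have [f fe] : exists f : onfam V, hs_sq T - e / 16 <= energy f T.
    have : hs_sq T - e / 16 < hs_sq T by rewrite ltrBlDr ltrDl.
    move=> /(sup_gt _)[|_ [f _ <-] /ltW fe]; last by exists f.
    by have [f _] := @onfam_span R V [::]; exists (energy f T), f.
  pose n := onfam_size f.
  (* Below, the real and imaginary parts of a coordinate differ by less than [2 * d] each, so a
     coordinate contributes at most [8 * d ^+ 2]. The choice of [c] and [d] keeps the total within
     [e / 4]; the added 1 keeps [c] positive. *)
  pose c := hs_sq T * (8 * n%:R) + 1.
  have c0 : 0 < c by rewrite ltr_wpDl// mulr_ge0 ?(hs_sq_ge0 TH)// mulr_ge0.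
  pose d := Num.sqrt (e / 4 / c).
  have d2 : d ^+ 2 = e / 4 / c by rewrite sqr_sqrtr// ltW// !divr_gt0.
  have d0 : 0 < d by rewrite sqrtr_gt0 !divr_gt0.
  have U1 : U [set x | nsq x <= 1] by apply: filterS (UB _ ltr01) => x [].
  have Ui (i : 'I_n) : exists pq : R * R, U [set x |
      `|pq.1 - complex.Re (inner x (f i))| < d /\ `|pq.2 - complex.Im (inner x (f i))| < d].
    have csq1 x : nsq x <= 1 -> csq (inner x (f i)) <= 1.
      move=> x1; apply: le_trans x1; apply: le_trans (bessel (@onfamP _ _ f) x).
      by rewrite (bigD1 i)//= lerDl; apply: sumr_ge0 => j _; exact: csq_ge0.
    have [|p Up] := @ultra_bounded R V U 1 d (fun x => complex.Re (inner x (f i))) UU d0.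
      apply: filterS U1 => x /csq1 /=; rewrite /csq => H.
      by rewrite -ler_sqr ?nnegrE// expr1n real_normK ?num_real// (le_trans _ H)// lerDl sqr_ge0.
    have [|q Uq] := @ultra_bounded R V U 1 d (fun x => complex.Im (inner x (f i))) UU d0.
      apply: filterS U1 => x /csq1 /=; rewrite /csq => H.
      by rewrite -ler_sqr ?nnegrE// expr1n real_normK ?num_real// (le_trans _ H)// lerDr sqr_ge0.
    by exists (p, q); exact: filterI.
  have [pq Upq] := choice Ui.
  exists ([set x | nsq x <= 1] `&` [set x | forall i,
      `|(pq i).1 - complex.Re (inner x (f i))| < d /\ `|(pq i).2 - complex.Im (inner x (f i))| < d]).
    by apply: filterI => //; exact: filter_forall.
  move=> x y [/= x1 xpq] [/= y1 ypq].
  have xy4 : nsq (x - y) <= 4.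
    by have := nsqD_le x (- y); rewrite nsqN; lra.
  rewrite -(subrK (proj_fam f (x - y)) (x - y)) (lin_D Tl) (le_trans (nsqD_le _ _))//.
  have H1 := onfam_orthogonal_small (x - y) fe.
  have H2 : nsq (T (proj_fam f (x - y))) <= e / 4.
    rewrite (le_trans (nsq_hs _ TH))// (nsq_sum_fam (@onfamP _ _ f)).
    apply: (@le_trans _ _ (hs_sq T * (\sum_(i < n) 8 * d ^+ 2))).
      rewrite ler_wpM2l ?(hs_sq_ge0 TH)//; apply: ler_sum => i _.
      have [xp xq] := xpq i; have [yp yq] := ypq i.
      rewrite innerBl /csq ReD ReN raddfB/=.
      move: xp xq yp yq; rewrite !ltr_distl.
      move: (complex.Re _) (complex.Im _) (complex.Re _) (complex.Im _) => a b a' b'.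
      move: (pq i) => [p q] /= /andP[? ?] /andP[? ?] /andP[? ?] /andP[? ?].
      have : (a - a') ^+ 2 <= 4 * d ^+ 2 by nra.
      have : (b - b') ^+ 2 <= 4 * d ^+ 2 by nra.
      lra.
    rewrite sumr_const card_ord -[_ *+ n]mulr_natr d2.
    rewrite (_ : hs_sq T * _ = (c - 1) * (e / 4 / c)); last by rewrite /c; ring.
    rewrite mulrBl mul1r mulrC divfK ?gt_eqF// lerBlDr lerDl.
    by rewrite ltW// !divr_gt0.
  apply: (@le_trans _ _ (2 * (e / 16 * 4) + 2 * (e / 4))); last by lra.
  by rewrite lerD// ler_pM2l// (le_trans H1)// ler_pM2l.
have : cvg U.
  apply: cauchy_cvg; apply/cauchyP => e e0.
  have eE : (complex.Re e)%:C = e by rewrite RRe_real// gtr0_real.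
  have d0 : 0 < complex.Re e by rewrite -ltcR eE.
  set d := complex.Re e in eE d0.
  have t0 := top_sq_gt0.
  (* Let tau be this tolerance. Then [nsq (T (y + x))] is at least [4 * top_sq] minus 5 tau, and the
     parallelogram law in the unit ball leaves at most 5 tau for [top_sq * nsq (y - x)], less than
     [top_sq * d ^+ 2]. *)
  have c0 : 0 < top_sq * d ^+ 2 / 8 by rewrite divr_gt0// mulr_gt0// exprn_gt0.
  have [A UA Ac] := Tc _ c0.
  have UAB : U (A `&` B (top_sq * d ^+ 2 / 8)) by apply: filterI => //; exact: UB.
  have [y [Ay [y1 yB]]] := filter_ex UAB.
  exists y; apply: filterS UAB => x [Ax [x1 xB]].
  rewrite -ball_normE/= -eE norm_lt_nsq; last exact: ltW.
  rewrite -(ltr_pM2l t0).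
  have := Ac _ _ Ay Ax; have := nsq_top (y + x).
  have := parallelogram y x; have := parallelogram (T y) (T x).
  rewrite -(lin_D Tl) -(lin_B Tl) => TP P P1 P2.
  have P3 : top_sq * (nsq (y + x) + nsq (y - x)) <= top_sq * 4.
    by rewrite ler_pM2l// P; lra.
  have P4 : 0 < top_sq * d ^+ 2 by rewrite mulr_gt0// exprn_gt0.
  move: P3; rewrite mulrDr; lra.
move=> /cvg_ex[w Uw].
have Tw : top_sq <= nsq (T w).
  apply/ler_addgt0Pr => e e0; rewrite -lerBlDr.
  have : nsq (T x) @[x --> U] --> nsq (T w) by apply: cvg_nsq; exact: hs_cvg.
  apply: (@closed_cvg _ _ U PU _ [set y | top_sq - e <= y]); first exact: closed_ge.
  by apply: filterS (UB e e0) => x [].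
have w1 : nsq w <= 1.
  have : nsq x @[x --> U] --> nsq w by exact: (@cvg_nsq R V V U id).
  apply: (@closed_cvg _ _ U PU (@nsq R V) [set y | y <= 1]); first exact: closed_le.
  by apply: filterS (UB _ ltr01) => x [].
have t0 := top_sq_gt0.
exists w.
  rewrite unfold_in eq_le nsq_top andbT (le_trans _ Tw)//.
  by rewrite ler_piMr// ltW.
by apply: contraTneq Tw => ->; rewrite (lin_0 Tl) nsq0 -ltNge.
Qed.

(** Each member of an orthonormal family in the space adds [top_sq] to the energy, so its size is at
    most [hs_sq T / top_sq]. A family of maximal size spans, since a nonzero remainder could be
    normalised and added. *)
Lemma top_space_finite : exists n (h : 'I_n -> V), [/\ orthonormal_fam h,
  forall i, h i \in top_space & forall x, x \in top_space -> proj_fam h x = x].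
Proof.
have t0 := top_sq_gt0.
pose P n := `[< exists h : 'I_n -> V, orthonormal_fam h /\ forall i, h i \in top_space >].
have P0 : exists n, P n by exists 0%N; apply/asboolP; exists (fun=> 0); split=> -[].
have Pb n : P n -> (n <= Num.bound (hs_sq T / top_sq))%N.
  move=> /asboolP[h [ho hW]]; rewrite -(ler_nat R) ltW//.
  apply: le_lt_trans (archi_boundP _); last by rewrite divr_ge0 ?(hs_sq_ge0 TH)// ltW.
  rewrite ler_pdivlMr// (le_trans _ (energy_le_hs (OnFam ho) TH))//.
  rewrite /energy/= -[n in leLHS]card_ord mulr_natl -sumr_const; apply: ler_sum => i _.
  have /eqP <- := hW i; rewrite (_ : nsq (h i) = 1) ?mulr1//.
  by apply: complexI; rewrite -nsqE ho eqxx.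
case: (ex_maxnP P0 Pb) => n /asboolP[h [ho hW]] nmax.
exists n, h; split=> // x xW; apply/eqP; rewrite eq_sym -subr_eq0.
apply: contraT => y0; have [a a1 _] := normalize y0.
suff /nmax : P n.+1 by rewrite ltnn.
apply/asboolP; exists (fam_cons h (a *: (x - proj_fam h x))); split.
  apply: fam_cons_orthonormal => // i.
  by rewrite innerZl innerBl inner_proj_fam_h// subrr mulr0.
have [W0 WP] := top_space_submod.
have Wproj : proj_fam h x \in top_space.
  by rewrite /proj_fam; elim/big_rec: _ => // i y _ yW; exact: WP.
move=> i; rewrite /fam_cons; case: unliftP => [j _|_]//.
rewrite -[_ *: _]addr0; apply: (WP) => //.
by rewrite addrC -scaleN1r; exact: WP.
Qed.

End TopEigenspace.

(** * The representation on a closed invariant subspace *)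

Section SubRepresentation.
Variables (R : realType) (V : hilbertType R) (W : {pred V}).
Hypotheses (Wsub : submod_closed W) (Wc : closed [set x | x \in W]).

Lemma sub_hilbert_complete (F : set_system V) : ProperFilter F ->
    (forall e : R, 0 < e -> exists A, [/\ F A, forall x, A x -> x \in W &
      forall x y, A x -> A y -> inner (x - y) (x - y) <= e%:C]) ->
    exists2 x, x \in W & forall e : R, 0 < e ->
      F [set y | inner (x - y) (x - y) <= e%:C].
Proof.
move=> PF Fc.
have : cvg F.
  apply: cauchy_cvg; apply/cauchyP => e e0.
  have eE : (complex.Re e)%:C = e by rewrite RRe_real// gtr0_real.
  have d0 : 0 < complex.Re e by rewrite -ltcR eE.
  have c0 : 0 < complex.Re e ^+ 2 / 2 by rewrite divr_gt0// exprn_gt0.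
  have [A [FA _ Ac]] := Fc _ c0; have [x Ax] := filter_ex FA.
  exists x; apply: filterS FA => y Ay.
  rewrite -ball_normE/= -eE norm_lt_nsq; last exact: ltW.
  have := Ac _ _ Ax Ay; rewrite nsqE lecR => /le_lt_trans; apply.
  by rewrite ltr_pdivrMr// ltr_pMr ?exprn_gt0// ltr1n.
move=> /cvg_ex[x Fx]; exists x.
  apply: (@closed_cvg _ _ F PF id [set x | x \in W] Wc) Fx.
  by have [A [FA AW _]] := Fc 1 ltr01; apply: filterS FA.
move=> e e0; have s0 : 0 < (Num.sqrt e)%:C :> R[i] by rewrite ltcR sqrtr_gt0.
have /cvgrPdist_lt/(_ _ s0) := Fx; apply: filterS => y.
by rewrite norm_lt_nsq ?sqrtr_ge0// sqr_sqrtr ?(ltW e0)//= nsqE lecR => /ltW.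
Qed.

Definition sub_data : hilbert_data R.
Proof.
apply: (@HilbertData R V W Wsub inner _ _ _ sub_hilbert_complete).
- by move=> a x y z _ _ _; rewrite innerDl innerZl.
- by move=> x y _ _; exact: innerC.
- by move=> x _ x0; rewrite dnorm_gt0.
Defined.

Lemma norm_sub_data (x : hilbert_of sub_data) : `|x| = `|\val x|.
Proof.
by apply/eqP; rewrite -(@eqrXn2 _ 2)// !inner_norm.
Qed.

Lemma sub_data_finite n (h : 'I_n -> V) : (forall i, h i \in W) ->
  (forall x, x \in W -> proj_fam h x = x) -> finite_dimensional (hilbert_of sub_data).
Proof.
move=> hW hP; exists n, (fun i => Sub (h i) (hW i) : hilbert_of sub_data) => x.
exists (fun i => inner (\val x) (h i)); apply/val_inj.
by rewrite raddf_sum/= -[LHS](hP _ (valP x)).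
Qed.

Variables (G : topGroupType) (rho : {multiplicative G -> unitary V}).
Hypothesis WG : forall g x, x \in W -> rho g x \in W.

Definition sub_op g (x : hilbert_of sub_data) : hilbert_of sub_data :=
  Sub (rho g (\val x)) (WG g (valP x)).

Lemma sub_op_linear g : linear (sub_op g).
Proof. by move=> a x y; apply: val_inj; exact: unitary_linear. Qed.

Lemma sub_op_inner g x y : inner (sub_op g x) (sub_op g y) = inner x y.
Proof. exact: (unitary_inner (rho g)). Qed.

Lemma sub_op_surj g y : exists x, sub_op g x = y.
Proof. by exists (sub_op g^-1%g y); apply: val_inj; exact: rhoVK. Qed.

Definition sub_rep g : unitary (hilbert_of sub_data) :=
  Unitary (sub_op_linear g) (sub_op_inner g) (sub_op_surj g).

Lemma sub_repM : {morph sub_rep : g h / (g * h)%g}.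
Proof. by move=> g h; apply: unitary_ext => x; apply: val_inj; exact: rhoM. Qed.

HB.instance Definition _ := isMultiplicative.Build G (unitary (hilbert_of sub_data))
  sub_rep sub_repM.

(** On a subspace the operator norm is a supremum over a smaller ball, so distances do not
    increase. *)
Lemma sub_rep_continuous : continuous rho -> continuous sub_rep.
Proof.
move=> rhoc g A /nbhs_ballP[e e0 eA]; apply: filterS (nbhs_rho rhoc g e0) => h gh.
apply: eA; apply: le_lt_trans gh; apply: unitary_dist_le => x x1.
rewrite norm_sub_data; apply: unitary_dist_ub.
by rewrite -norm_sub_data.
Qed.

End SubRepresentation.

Theorem theorem1p4 (R : realType) (H : hilbertType R)
    (G : subgroup (unitary H)) :
  amenable R (subgroup_type G) -> property_T R (subgroup_type G) ->
  maximally_almost_periodic R (subgroup_type G).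
Proof.
move=> amG pT g h gh; apply: contrapT => nosep.
pose rho : {multiplicative subgroup_type G -> unitary H} := \val.
have rhoc : continuous rho by exact: (@initial_continuous _ _ (set_val : set_type G -> unitary H)).
(* Quantifying over [k] makes this the largest invariant subspace on which [rho g] and [rho h]
   agree. *)
pose Z := [set x | forall k, rho (g * k)%g x = rho (h * k)%g x].
have ZG k x : Z x -> Z (rho k x).
  by move=> Zx l; rewrite -!(rhoM rho) -!mulgA; exact: Zx.
pose u := (g^-1 * h)%g.
have uZ x : Z x -> rho u x = x.
  by move=> /(_ 1%g); rewrite !mulg1 => gx; rewrite rhoM -gx rhoK.
(* The range of [rho u - 1] is orthogonal to the fixed vectors of the unitary [rho u], among them
   [Z]; this yields [x0] without a projection onto [Z]. *)
have [x0 x01 Zx0] : exists2 x0, nsq x0 = 1 & forall z, Z z -> inner z x0 = 0.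
  have [y gy] : exists y, rho g y <> rho h y.
    apply: contrapT => /forallNP gy; apply: gh; apply: val_inj.
    by apply: unitary_ext => y; exact: contrapT (gy y).
  have y0 : rho u y - y != 0.
    rewrite subr_eq0; apply/eqP => uy; apply: gy.
    by rewrite -[in LHS]uy rhoM rhoVK.
  have [a a1 _] := normalize y0; exists (a *: (rho u y - y)) => // z Zz.
  by rewrite innerZr innerBr -{1}(uZ z Zz) unitary_inner subrr mulr0.
have [T [TH T0 TG]] := invariant_hs_operator ZG rhoc amG pT x01 Zx0.
have [w wW w0] := top_space_neq0 TH T0.
have [n [b [bo bW bP]]] := top_space_finite TH T0.
have WG k x : x \in top_space T -> rho k x \in top_space T.
  by rewrite !unfold_in TG !nsq_unitary.
have Wsub := top_space_submod TH; have Wc := top_space_closed TH.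
have sep : sub_rep Wsub Wc WG g = sub_rep Wsub Wc WG h.
  apply: contrapT => gh'; apply: nosep.
  exists (hilbert_of (sub_data Wsub Wc)), (sub_rep Wsub Wc WG); split=> //.
    exact: sub_data_finite bW bP.
  exact: sub_rep_continuous.
have WE x : x \in top_space T -> rho g x = rho h x.
  move=> xW; pose v : hilbert_of (sub_data Wsub Wc) := Sub x xW.
  have : sub_rep Wsub Wc WG g v = sub_rep Wsub Wc WG h v by rewrite sep.
  by move/(congr1 \val).
have Zw : Z w by move=> k; rewrite !(rhoM rho) WE// WG.
have /asboolP[_ _ /(_ w Zw) Tw0] := TH.
move: wW; rewrite unfold_in Tw0 nsq0 mulf_eq0 nsq_eq0 (negPf w0) orbF.
by rewrite gt_eqF// (top_sq_gt0 TH T0).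
Qed.
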